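(* Let $1<p<\infty$ and let $T\colon X_\omega\to X_\omega$ be a bounded linear operator. Then $T$ is a distributional embedding if and only if there exist (i) a map $\kappa\colon\mathbb{N}\to\mathbb{N}$ such that, for every $k\in\mathbb{N}$, the fibre $I_k:=\kappa^{-1}(\{k\})$ is finite, (ii) for every $k\in\mathbb{N}$, a measure-preserving map $\Phi_k\colon\Omega_k\to\prod_{n\in I_k}\Omega_n$ (from the uniform measure $\mu_k$ to the product measure $\prod_{n\in I_k}\mu_n$), such that $\sum_{n\in I_k}n\le k$ for every $k\in\mathbb{N}$, and $$T\left(\sum_{n=1}^{N}J_nf_n\right)=\sum_{k=1}^{\infty}J_k\left(\sum_{n\in I_k\cap\{1,\dots,N\}}f_n\circ\mathrm{pr}_n\circ\Phi_k\right)$$ for every $N\in\mathbb{N}$ and every finite family $f_1,\dots,f_N$ with $f_n\in H_n$, where for each $n\in I_k$, $\mathrm{pr}_n\colon\prod_{m\in I_k}\Omega_m\to\Omega_n$ denotes the canonical coordinate projection. (In the formula, only finitely many terms of the sum over $k$ are non-zero.)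
   Context: All function spaces are real, $1<p<\infty$ is fixed, and $\mathbb{N}=\{1,2,\dots\}$. For $n\in\mathbb{N}$, $\Omega_n=\{0,1\}^n$ carries the uniform probability measure $\mu_n$ (on its power set), and $H_n=\{f\in L^p(\Omega_n,\mu_n):\int_{\Omega_n}f\,d\mu_n=0\}$. Let $(\Omega,\Sigma,\mu)=\prod_{n=1}^\infty(\Omega_n,\mathcal{P}(\Omega_n),\mu_n)$ be the product probability space, $\pi_n\colon\Omega\to\Omega_n$ the $n$-th coordinate projection, and $J_n\colon L^p(\Omega_n,\mu_n)\to L^p(\Omega,\mu)$, $J_nf=f\circ\pi_n$. Let $X_\omega$ be the closure in $L^p(\Omega)$ of $\operatorname{span}\{J_n(H_n):n\in\mathbb{N}\}$; it is a concrete realization of the centered first limit Bourgain--Rosenthal--Schechtman space $R_\omega^{p,0}$. For a real random variable $f$, $\operatorname{dist}(f)$ is its distribution (the push-forward Borel probability measure on $\mathbb{R}$). A linear operator $T\colon X_\omega\to X_\omega$ is a distributional embedding if $\operatorname{dist}(Tx)=\operatorname{dist}(x)$ for every $x\in X_\omega$. Conventions: a product indexed by the empty set is the one-point probability space; empty sums are zero. *)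

(* Defs.v *)
From HB Require Import structures.
From mathcomp Require Import all_boot all_order all_algebra finmap.
From mathcomp Require Import all_classical all_reals all_analysis.
From mathcomp Require Import measurable_realfun.

Set Implicit Arguments.
Unset Strict Implicit.
Unset Printing Implicit Defensive.
Import Order.TTheory GRing.Theory Num.Theory.
Import numFieldNormedType.Exports.
Local Open Scope classical_set_scope.
Local Open Scope ring_scope.

(* The index set {1, 2, ...} is encoded as nat through n |-> n.+1 : [cube n] is
   the cube {0,1}^(n+1), with its power set as sigma-algebra. *)
Definition cube (n : nat) : Type := {ffun 'I_n.+1 -> bool}.

HB.instance Definition _ (n : nat) := Finite.on (cube n).
HB.instance Definition _ (n : nat) := isPointed.Build (cube n) [ffun=> false].
HB.instance Definition _ (n : nat) :=
  @isMeasurable.Build default_measure_display (cube n) discrete_measurable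
    discrete_measurable0 discrete_measurableC discrete_measurableU.

(* Counting measure divided by its (positive, finite) total mass; [dirac point]
   is the value [mnormalize] takes on measures that cannot be normalized. *)
Definition cube_prob (R : realType) (n : nat) : probability (cube n) R :=
  mnormalize (@counting (cube n) R) (dirac point).

Section product_space.
Context (I : choiceType) (n_ : I -> nat).

(* prod_(i : I) {0,1}^(n_ i + 1), with the sigma-algebra generated by the
   coordinate projections. *)
Definition cube_prod : Type := forall i : I, cube (n_ i).

HB.instance Definition _ := Pointed.on cube_prod.

Definition coord_sets : set (set cube_prod) :=
  [set B | exists i (A : set (cube (n_ i))), B = [set x | A (x i)]].

HB.instance Definition _ := @isMeasurable.Build (sigma_display coord_sets)
  cube_prod <<s coord_sets >> (@sigma_algebra0 _ setT coord_sets)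
  (@sigma_algebraC _ coord_sets)
  (@sigma_algebra_bigcup _ setT coord_sets).

End product_space.
Arguments coord_sets {I} n_.

Lemma card_cube_gt0 n : (0 < #|{: cube n}|)%N.
Proof. by apply/card_gt0P; exists point. Qed.

Lemma cube_probE (R : realType) n (A : set (cube n)) :
  cube_prob R n A = (#|[pred x | x \in A]|%:R / #|{: cube n}|%:R)%:E.
Proof.
have cE (B : set (cube n)) :
    @counting (cube n) R B = #|[pred x | x \in B]|%:R%:E.
  have fB : finite_set B by exact: finite_finset.
  rewrite /counting asboolT//; congr (_%:R%:E).
  rewrite cardE; apply: perm_size; apply: uniq_perm;
    [exact: fset_uniq|exact: enum_uniq|].
  by move=> x; rewrite in_fset_set// mem_enum.
have cT : @counting (cube n) R setT = #|{: cube n}|%:R%:E.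
  rewrite cE; congr (_%:R%:E); apply: eq_card => x; rewrite !inE.
  exact: mem_set.
rewrite /cube_prob /= /mnormalize/= !cT ifF; last first.
  by rewrite eqe pnatr_eq0 orbF gtn_eqF// card_cube_gt0.
by rewrite cE -EFinM.
Qed.

(* The cubes are read off the mixed radix digits of a uniform point of [0,1];
   this realizes product probabilities as distributions. *)
Section digits.
Context (R : realType).

Let base (N : nat) : nat := \prod_(i < N) #|{: cube i}|.

Let base_gt0 N : (0 < base N)%N.
Proof. by rewrite prodn_gt0// => i; exact: card_cube_gt0. Qed.

Let bit n (v : nat) : cube n :=
  nth point (enum {: cube n}) (v %% #|{: cube n}|).

Definition cube_digit n (x : R) : cube n :=
  bit n (Num.truncn (x * (base n.+1)%:R)).

Let measurable_truncn_eq (b v : nat) :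
  measurable [set x : R | Num.truncn (x * b.+1%:R) = v].
Proof.
have mle w : measurable [set x : R | (Num.truncn (x * b.+1%:R) <= w)%N].
  rewrite (_ : [set _ | _] = `]-oo, (w.+1%:R / b.+1%:R)[%classic).
    exact: measurable_itv.
  by apply/seteqP; split => x /=; rewrite in_itv/= truncn_le_nat ltr_pdivlMr.
case: v => [|v].
  rewrite (_ : [set _ | _] = [set x | (Num.truncn (x * b.+1%:R) <= 0)%N])//.
  by apply/seteqP; split => x /=; rewrite leqn0 => /eqP.
rewrite (_ : [set _ | _] = [set x | (Num.truncn (x * b.+1%:R) <= v.+1)%N] `\`
  [set x | (Num.truncn (x * b.+1%:R) <= v)%N]); first exact: measurableD.
apply/seteqP; split => x /=; first by move=> ->; rewrite leqnn ltnn.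
by move=> [] h1 /negP; rewrite -ltnNge => h2; apply/eqP; rewrite eqn_leq h1 h2.
Qed.

Lemma measurable_cube_digit n : measurable_fun [set: R] (@cube_digit n).
Proof.
move=> _ A _; rewrite setTI.
have [b bE] : exists b, base n.+1 = b.+1.
  by exists (base n.+1).-1; rewrite prednK.
rewrite (_ : _ @^-1` _ = \bigcup_(v in [set v | A (bit n v)])
   [set x : R | Num.truncn (x * b.+1%:R) = v]).
  by apply: bigcup_measurable => v _; exact: measurable_truncn_eq.
apply/seteqP; split => [x /= Ax|x [v/= Av xv]].
  by exists (Num.truncn (x * b.+1%:R)) => //=; rewrite -bE.
by rewrite /= /cube_digit bE xv.
Qed.

Let truncn_divn (y : R) (c : nat) : 0 <= y -> (0 < c)%N ->
  (Num.truncn (y * c%:R) %/ c)%N = Num.truncn y.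
Proof.
move=> y0 c0.
have key m : (m <= Num.truncn (y * c%:R) %/ c)%N = (m <= Num.truncn y)%N.
  rewrite leq_divRL// !truncn_ge_nat ?mulr_ge0// natrM ler_pM2r//.
  by rewrite ltr0n.
by apply/eqP; rewrite eqn_leq -key leqnn/= key leqnn.
Qed.

Let Fixpoint word (A : forall n, set (cube n)) (N v : nat) : bool :=
  if N is n.+1 then word A n (v %/ #|{: cube n}|) && (bit n v \in A n) else true.

Let baseS N : base N.+1 = (base N * #|{: cube N}|)%N.
Proof. by rewrite /base big_ord_recr. Qed.

Let wordP (A : forall n, set (cube n)) N (x : R) : 0 <= x ->
  (forall n, (n < N)%N -> A n (cube_digit n x)) <->
  word A N (Num.truncn (x * (base N)%:R)).
Proof.
move=> x0; elim: N => [|N IH] //=.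
rewrite {1}baseS natrM mulrA truncn_divn ?mulr_ge0 ?card_cube_gt0//.
split => [h|/andP[/IH h1 /set_mem h2] n].
  apply/andP; split; first by apply/IH => n nN; apply: h; rewrite ltnS ltnW.
  by apply/mem_set; exact: h.
by rewrite ltnS leq_eqVlt => /predU1P[->|/h1].
Qed.

Let sum_word A N : (\sum_(0 <= v < base N) word A N v =
  \prod_(n < N) #|[pred x : cube n | x \in A n]|)%N.
Proof.
elim: N => [|N IH].
  by rewrite /base !big_ord0 big_nat1.
rewrite baseS big_nat_mul big_ord_recr/= -IH big_distrl/=.
apply: eq_bigr => u _.
have c0 := card_cube_gt0 N.
rewrite -{1}(add0n (u * #|{: cube N}|)%N) big_addn mulSn addnK.
have -> : #|[pred x | x \in A N]| =
    (\sum_(0 <= j < #|{: cube N}|) (nth point (enum {: cube N}) j \in A N))%N.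
  rewrite -sum1_card big_mkcond/= -big_enum/= (big_nth point) -cardE.
  by apply: eq_bigr => j _; case: ifPn; rewrite inE => // /negbTE ->.
rewrite big_distrr/= !big_nat; apply: eq_bigr => j /andP[_ jc].
rewrite divnDMl// divn_small// add0n /bit (addnC j) modnMDl modn_small//.
by rewrite mulnb.
Qed.

Let U : probability _ R := uniform_prob (@ltr01 R).

Let uniform01 (S : pred nat) (a : nat) : (0 < a)%N ->
  U [set x | S (Num.truncn (x * a%:R))] =
  ((\sum_(0 <= v < a) S v)%:R / a%:R)%:E.
Proof.
case: a => // b _; set a := b.+1.
have a0R : 0 < a%:R :> R by rewrite ltr0n.
pose J (v : nat) : set R := `[v%:R / a%:R, v.+1%:R / a%:R[%classic.
have JE v x : J v x <-> 0 <= x /\ Num.truncn (x * a%:R) = v.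
  rewrite /J/= in_itv/= ler_pdivrMr// ltr_pdivlMr//; split.
    move=> /andP[vx xv].
    have xa0 : 0 <= x * a%:R by apply: le_trans vx.
    split; first by move: xa0; rewrite pmulr_lge0.
    by apply/eqP; rewrite eqn_leq truncn_le_nat xv/= truncn_ge_nat.
  move=> [x0 <-]; have xa0 : 0 <= x * a%:R by rewrite mulr_ge0.
  by rewrite -truncn_ge_nat// leqnn/= -truncn_le_nat.
have mJ v : measurable (J v) by exact: measurable_itv.
have Jmeas v : lebesgue_measure (J v) = (a%:R^-1)%:E :> \bar R.
  rewrite lebesgue_measure_itv/= lte_fin ltr_pM2r ?invr_gt0// ltr_nat ltnSn.
  by rewrite -EFinB -mulrBl -natrB// subSnn mul1r.
set B := [set x | _].
have mB : measurable B.
  rewrite (_ : B = \bigcup_(v in [set v | S v])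
      [set x : R | Num.truncn (x * b.+1%:R) = v]).
    by apply: bigcup_measurable => v _; exact: measurable_truncn_eq.
  by apply/seteqP; split => [x Bx|x [v/= Sv xv]];
    [exists (Num.truncn (x * b.+1%:R))|rewrite /B/= xv].
have UE : U B = lebesgue_measure (B `&` `[0, 1]).
  rewrite /U/= /uniform_prob integral_uniform_pdf.
  rewrite (eq_integral (cst 1%E)) ?integral_cst ?mul1e//.
    by apply: measurableI => //; exact: measurable_itv.
  move=> x; rewrite inE => -[_ /=]; rewrite in_itv/= => x01.
  by rewrite /uniform_pdf x01 subr0 invr1.
pose F v := if S v then J v else set0.
have mF v : measurable (F v) by rewrite /F; case: ifP.
have tF : trivIset setT F.
  apply/trivIsetP => i j _ _ /eqP ij; rewrite -subset0 => x [].
  rewrite /F; case: ifP => // _; case: ifP => // _.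
  by move=> /JE[_ xi] /JE[_ xj]; apply: ij; rewrite -xi.
have m1 : measurable (B `&` [set 1]) by exact: measurableI.
have BE : B `&` `[0, 1] =
    \big[setU/set0]_(v < a) F v `|` (B `&` [set 1]).
  rewrite -bigcup_mkord; apply/seteqP; split => x /=.
    move=> [Bx]; rewrite in_itv/= => /andP[x0 x1].
    have [x1'|xn1] := eqVneq x 1; first by right.
    left; exists (Num.truncn (x * a%:R)).
      rewrite /= truncn_lt_nat ?mulr_ge0//.
      by rewrite gtr_pMl// lt_neqAle xn1.
    by move: Bx; rewrite /F /B/= => ->; apply/JE.
  move=> [[v /= va]|[Bx x1]]; last first.
    by split=> //; rewrite x1 /= in_itv/= ler01 lexx.
  rewrite /F; case: ifPn => // Sv /JE[x0 xv].
  split; first by rewrite /B/= xv.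
  rewrite in_itv/= x0/= leNgt; apply/negP => x1.
  move: va; rewrite -xv ltnNge truncn_ge_nat ?mulr_ge0//.
  by rewrite ler_pMl// ltW.
rewrite UE BE measureU0//.
- rewrite measure_bigsetU// big_mkord natr_sum mulr_suml -sumEFin.
  apply: eq_bigr => v _; rewrite /F.
  case: ifP => _; first by rewrite mul1r; exact: Jmeas.
  rewrite mul0r; exact: measure0.
- by apply: bigsetU_measurable => v _; exact: mF.
- have h := @subset_measure0 _ _ _ (@lebesgue_measure R) _ [set 1] m1 (measurable_set1 1) _ (lebesgue_measure_set1 1).
  by apply: h => x [].
Qed.

Lemma cube_digit_rectangle (A : forall n, set (cube n)) N :
  uniform_prob (@ltr01 R) [set x | forall n, (n < N)%N -> A n (cube_digit n x)] =
  (\prod_(n < N) cube_prob R n (A n))%E.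
Proof.
rewrite -/U; transitivity (U [set x | word A N (Num.truncn (x * (base N)%:R))]).
  rewrite /U/= /uniform_prob integral_uniform_pdf [RHS]integral_uniform_pdf.
  congr (\int[_]_(x in _) _)%E.
  apply/seteqP; split => x [/= hx]; rewrite in_itv/= => x01; split=> //=;
    by move: hx; case/andP: x01 => x0 _; move/(wordP A N x0).
rewrite uniform01// sum_word.
under [RHS]eq_bigr do rewrite cube_probE.
by rewrite prodEFin /base natr_prod natr_prod prodf_div.
Qed.

End digits.

Section measurable_product.
Context (I : choiceType) (n_ : I -> nat).

Lemma measurable_coord i : measurable_fun [set: cube_prod n_] (fun x => x i).
Proof. by move=> _ A _; rewrite setTI; apply: sub_sigma_algebra; exists i, A. Qed.

Lemma measurable_fun_cube_prod d (T : measurableType d) (f : T -> cube_prod n_) :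
  (forall i, measurable_fun [set: T] (fun x => f x i)) ->
  measurable_fun [set: T] f.
Proof.
move=> mf; apply: (measurability (coord_sets n_)) => //.
by move=> _ [_ [i [A ->]] <-]; exact: (mf i).
Qed.

End measurable_product.

(* The defining property of the product of the uniform probabilities: see
   [product_prob_exists] and [product_prob_unique]. The construction of
   [product_prob_exists] draws the cube i from the digit n_ i, which is why it
   takes [n_] injective. *)
Definition is_product_prob (R : realType) (I : choiceType) (n_ : I -> nat)
    (P : probability (cube_prod n_) R) :=
  forall (J : {fset I}) (A : forall i, set (cube (n_ i))),
    P [set x | forall i, i \in J -> A i (x i)] =
    (\prod_(i <- J) cube_prob R (n_ i) (A i))%E.

Lemma product_prob_exists (R : realType) (I : choiceType) (n_ : I -> nat) :
  injective n_ -> exists P : probability (cube_prod n_) R, is_product_prob P.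
Proof.
move=> n_inj.
pose X (x : measurableTypeR R) : cube_prod n_ := fun i => cube_digit (n_ i) x.
have mX : measurable_fun [set: measurableTypeR R] X.
  by apply: measurable_fun_cube_prod => i; exact: measurable_cube_digit.
pose Xm : {mfun measurableTypeR R >-> cube_prod n_} := HB.pack X (isMeasurableFun.Build _ _ _ _ X mX).
exists (distribution (uniform_prob (@ltr01 R)) Xm) => J A.
pose N := (\max_(i <- J) n_ i).+1.
have JN i : i \in J -> (n_ i < N)%N.
  by move=> iJ; rewrite ltnS; exact: leq_bigmax_seq.
pose A' m : set (cube m) := [set y | forall i (e : n_ i = m), i \in J ->
  A i (ecast m (cube m) (esym e) y)].
have A'E i : i \in J -> A' (n_ i) = A i.
  move=> iJ; apply/seteqP; split => y /=; first by move=> /(_ i erefl iJ).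
  move=> Ay j e jJ; have ij := n_inj _ _ e; subst j.
  by rewrite (eq_irrelevance e erefl).
have A'T m : m \notin [seq n_ i | i <- J] -> A' m = setT.
  move=> mJ; apply/seteqP; split => // y _ i e iJ.
  have mJ' : m \in [seq n_ i | i <- J] by rewrite -e map_f.
  by rewrite mJ' in mJ.
rewrite /distribution/= /pushforward.
rewrite (_ : _ @^-1` _ =
    [set x | forall m, (m < N)%N -> A' m (cube_digit m x)]); last first.
  apply/seteqP; split => x /= h.
    by move=> m mN i e iJ; subst m; exact: h.
  by move=> i iJ; rewrite -A'E//; apply: h; exact: JN.
rewrite cube_digit_rectangle.
rewrite (eq_big_seq (fun i => cube_prob R (n_ i) (A' (n_ i)))); last first.
  by move=> i iJ; rewrite A'E.
rewrite -(big_map n_ xpredT (fun m => cube_prob R m (A' m))).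
rewrite -(big_mkord xpredT (fun m => cube_prob R m (A' m))).
rewrite (bigID (mem [seq n_ i | i <- J]))/= [X in (_ * X)%E]big1 ?mule1.
  rewrite -big_filter; apply: perm_big; apply: uniq_perm.
  - by rewrite filter_uniq// iota_uniq.
  - by rewrite map_inj_uniq.
  move=> m; rewrite mem_filter mem_index_iota/=; apply/andP/idP => [[]//|mJ].
  by split => //; move/mapP: mJ => [i iJ ->]; exact: JN.
by move=> m mJ; rewrite A'T// probability_setT.
Qed.

Lemma product_prob_unique (R : realType) (I : choiceType) (n_ : I -> nat)
    (P Q : probability (cube_prod n_) R) :
  is_product_prob P -> is_product_prob Q ->
  forall A, measurable A -> P A = Q A.
Proof.
move=> PP PQ.
pose G : set (set (cube_prod n_)) :=
  [set B | exists (J : {fset I}) (A : forall i, set (cube (n_ i))),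
     B = [set x | forall i, i \in J -> A i (x i)]].
apply: (measure_unique G (fun=> setT)).
- apply/seteqP; split; apply: smallest_sub; try exact: smallest_sigma_algebra.
    move=> _ [i [A ->]]; apply: sub_sigma_algebra.
    exists [fset i]%fset, (fun j => [set y | forall e : j = i,
      A (ecast k (cube (n_ k)) e y)]).
    apply/seteqP; split => x /= h.
      by move=> j /fset1P ji e; subst j; rewrite (eq_irrelevance e erefl).
  exact: (h i (fset11 i) erefl).
  move=> _ [J [A ->]].
  rewrite (_ : [set x | _] = \bigcap_(i in [set` J]) [set x | A i (x i)]).
    by apply: fin_bigcap_measurable => // i _; apply: sub_sigma_algebra; exists i, (A i).
  by apply/seteqP; split => x /= h i; exact: h.
- move=> _ _ [J [A ->]] [K [B ->]].
  exists (J `|` K)%fset, (fun i => [set y | (i \in J -> A i y) /\ (i \in K -> B i y)]).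
  apply/seteqP; split => x /=.
    by move=> [h1 h2] i _; split => ?; [exact: h1|exact: h2].
  move=> h; split=> i iJ; have := h i; rewrite inE iJ ?orbT => /(_ isT)[h1 h2];
    by [exact: h1|exact: h2].
- move=> _; exists fset0, (fun=> setT).
  by apply/seteqP; split.
- by rewrite bigcup_const.
- by move=> _ [J [A ->]]; exact: etrans (PP J A) (esym (PQ J A)).
- by move=> _; apply: (le_lt_trans (probability_le1 P measurableT)); exact: ltry.
Qed.

Definition product_prob (R : realType) (I : choiceType) (n_ : I -> nat)
    (n_inj : injective n_) : probability (cube_prod n_) R :=
  projT1 (cid (product_prob_exists R n_inj)).

Lemma product_probP (R : realType) (I : choiceType) (n_ : I -> nat)
  (n_inj : injective n_) : is_product_prob (product_prob R n_inj).
Proof. exact: (projT2 (cid (product_prob_exists R n_inj))). Qed.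

Notation Omega := (cube_prod (@idfun nat)).

Definition Omega_prob (R : realType) : probability Omega R :=
  product_prob R (@inj_id nat).

Lemma lt1_le1E (R : realType) (p : R) : 1 < p -> (1 <= p%:E)%E.
Proof. by rewrite lee_fin; exact: ltW. Qed.

Definition linear_span (R : nzRingType) (V : lmodType R) (S : set V) : set V :=
  [set v | exists m (c : 'I_m -> R) (s : 'I_m -> V),
    (forall i, S (s i)) /\ v = \sum_(i < m) c i *: s i].

(* Elements of L^p are represented by functions of [LfunType mu p1], two of
   which denote the same element when they are equal almost everywhere. *)
Section Lp.
Context d (T : measurableType d) (R : realType) (mu : {measure set T -> \bar R})
  (p : \bar R) (p1 : (1 <= p)%E).
Local Notation Lp := (LfunType mu p1).

Definition Lp_closure (S : set Lp) : set Lp :=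
  [set f | forall e : R, 0 < e ->
    exists2 g, S g & ('N[mu]_p[EFin \o (f - g)%R] < e%:E)%E].

(* [F] induces a bounded linear operator from the subspace [X] of L^p to itself;
   the values of [F] outside [X] are irrelevant. *)
Definition bounded_linear_on (X : set Lp) (F : Lp -> Lp) : Prop :=
  [/\ forall f, X f -> X (F f),
      forall f g, X f -> X g -> f = g %[ae mu] -> F f = F g %[ae mu],
      forall (a : R) f g, X f -> X g ->
        F (a *: f + g) = a *: F f + F g %[ae mu]
    & exists C : R, forall f, X f ->
        ('N[mu]_p[EFin \o F f] <= C%:E * 'N[mu]_p[EFin \o f])%E].

End Lp.

Section R_omega.
Context (R : realType) (p : R) (p1 : (1 <= p%:E)%E).

Lemma bounded_Lfun d (T : measurableType d) (P : probability T R)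
    (f : T -> R) (M : R) :
  measurable_fun [set: T] f -> (forall x, `|f x| <= M) -> f \in Lfun P p%:E.
Proof.
move=> mf fM; rewrite inE; apply/andP; split; rewrite inE//=.
have p0 : 0 < p by rewrite -lte_fin (lt_le_trans _ p1).
rewrite /finite_norm unlock/=; apply: poweR_lty.
apply: (@le_lt_trans _ _ (\int[P]_x (cst (M `^ p)%:E x))%E).
  apply: ge0_le_integral => //.
    apply/measurable_EFinP; apply: (@measurableT_comp _ _ _ _ _ _ (@powR R ^~ p)) => //.
    exact: measurableT_comp.
  move=> x _; rewrite /= lee_fin ge0_ler_powR ?nnegrE ?(ltW p0)//.
  exact: le_trans (fM x).
rewrite integral_cst//; apply: lte_mul_pinfty; rewrite ?lee_fin ?powR_ge0//.
exact: le_lt_trans (probability_le1 P measurableT) (ltry _).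
Qed.

Lemma cube_Lfun n (f : cube n -> R) : f \in Lfun (cube_prob R n) p%:E.
Proof.
apply: (@bounded_Lfun _ _ _ _ (\sum_(x : cube n) `|f x|)) => // x.
by rewrite (bigD1 x)//= lerDl sumr_ge0.
Qed.

(* Every real function on the finite space [cube n] is in L^p. *)
Definition cube_Lp n (f : cube n -> R) : LfunType (cube_prob R n) p1 :=
  Lfun_Sub p1 (cube_Lfun f).

Lemma coord_Lfun n (f : cube n -> R) :
  (fun x : Omega => f (x n)) \in Lfun (Omega_prob R) p%:E.
Proof.
apply: (@bounded_Lfun _ _ _ _ (\sum_(x : cube n) `|f x|)) => [|x].
  exact: (measurableT_comp _ (@measurable_coord _ (@idfun nat) n)).
by rewrite (bigD1 (x n))//= lerDl sumr_ge0.
Qed.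

(* J_n f = f \o pi_n. *)
Definition coord_embed n (f : LfunType (cube_prob R n) p1) :
    LfunType (Omega_prob R) p1 :=
  Lfun_Sub p1 (coord_Lfun f).

(* H_n. *)
Definition mean_zero n : set (LfunType (cube_prob R n) p1) :=
  [set f | (\int[cube_prob R n]_x (f x)%:E = 0)%E].

Definition X_omega : set (LfunType (Omega_prob R) p1) :=
  Lp_closure (linear_span (\bigcup_n (@coord_embed n @` @mean_zero n))).

Definition distributional_embedding
    (F : LfunType (Omega_prob R) p1 -> LfunType (Omega_prob R) p1) : Prop :=
  forall f, X_omega f -> forall A, measurable A ->
    distribution (Omega_prob R) (F f) A = distribution (Omega_prob R) f A.

End R_omega.
Arguments X_omega {R p} p1.
Arguments mean_zero {R p} p1 n.
Arguments coord_embed {R p p1 n} f.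
Arguments cube_Lp {R p} p1 {n} f.
Arguments distributional_embedding {R p p1} F.

Definition measure_preserving d1 d2 (T1 : measurableType d1)
    (T2 : measurableType d2) (R : realType) (P1 : probability T1 R)
    (P2 : probability T2 R) (f : T1 -> T2) : Prop :=
  measurable_fun [set: T1] f /\
  forall A, measurable A -> P1 (f @^-1` A) = P2 A.

Notation fibre kappa k := {n : nat | kappa n == k}.

Definition fibre_idx (kappa : nat -> nat) (k : nat) : fibre kappa k -> nat :=
  val.
Arguments fibre_idx : clear implicits.

Lemma fibre_idx_inj (kappa : nat -> nat) (k : nat) :
  injective (fibre_idx kappa k).
Proof. exact: val_inj. Qed.

(* Main.v *)
Require Import Defs.
From HB Require Import structures.
From mathcomp Require Import all_boot all_order all_algebra finmap.
From mathcomp Require Import all_classical all_reals all_analysis.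
From mathcomp Require Import measurable_realfun.
From mathcomp Require Import ring lra.

Set Implicit Arguments.
Unset Strict Implicit.
Unset Printing Implicit Defensive.
Import Order.TTheory GRing.Theory Num.Theory.
Import numFieldNormedType.Exports.
Local Open Scope classical_set_scope.
Local Open Scope ring_scope.
(** The heart of the matter is [two_valued_coord]: an element Y of X_omega that
takes only two values depends on a single coordinate. Write y_k for the
conditional mean of Y given the k-th coordinate. Since Y is a limit of sums of
independent centered functions of the coordinates, E(Y^2 y_k y_l), for k <> l,
is 2 E(y_k^2) E(y_l^2). But Y takes two values,
so Y^2 is an affine function of Y, and Y has no component along a product of
two centered functions of distinct coordinates. Hence
E(y_k^2) E(y_l^2) = 0: at most one y_k is nonzero, and Y = y_k.
The approximants of Y converge only in L^p, possibly with p < 2; membership in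
X_omega therefore enters through the bounded functions F orthogonal to every
J_n H_n, which Y annihilates ([weakly_additive], [X_omega_weakly_additive]).

If T is a distributional embedding and e_A = 1_A - mu_n(A) for a subset A of
Omega_n, then T(J_n e_A) has two values, so it is 1_B(x_k) - mu_n(A) for some
k and B ([image_centered]). A sum of functions 1_S - c attains its
largest conceivable value exactly on the intersection of the sets S, so the
equality of the distributions of a sum of J_n e_A and of its image says that
intersections of the events on the two sides have the same probability
([joint_law]). For distinct points w, v of Omega_n the events attached to
e_w and e_v are therefore disjoint, which is impossible for events of positive
probability depending on different coordinates; so all of them depend on the
same coordinate kappa(n). As the e_w add up to zero, these events partition
Omega_kappa(n), whence a map phi_n with T(J_n f) = f o phi_n o pi_kappa(n)
([image_coord_embed]). Used once more, [joint_law] gives that the family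
(phi_n(x_kappa(n)))_n has the law of (x_n)_n. Restricted to a fibre of kappa
this is the measure preservation of Phi_k. A point of the product over the fibre
of k has probability 2^-(sum of n), and this is a multiple of 2^-k, the
probability of a point of Omega_k; so the sum of n over the fibre is at most k ([fibre_sum_le]).

Conversely, the maps Phi_k glue to a measure-preserving map Psi of Omega
([glue_preserving]), because distinct fibres use distinct, hence independent,
coordinates. The formula says that T f = f o Psi on the span of the J_n H_n, and
by density and boundedness on X_omega ([operator_comp]). *)

(** * Expectation of bounded functions *)

Section bounded_functions.
Context d (T : measurableType d) (R : realType) (P : probability T R).
Implicit Types f g : T -> R.

(** Boundedness is required everywhere, not almost everywhere, so that the class
is closed under products and all of its expectations make sense without
integrability conditions. *)
Definition bounded_mfun f : Prop :=
  measurable_fun [set: T] f /\ exists M, forall x, `|f x| <= M.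

Definition expect f : R := \int[P]_x f x.

Lemma bounded_mfun_cst c : bounded_mfun (cst c).
Proof. by split=> //; exists `|c|. Qed.

Lemma bounded_mfunD f g : bounded_mfun f -> bounded_mfun g ->
  bounded_mfun (fun x => f x + g x).
Proof.
move=> [mf [M fM]] [mg [N gN]]; split; first exact: measurable_funD.
by exists (M + N) => x; rewrite (le_trans (ler_normD _ _))// lerD.
Qed.

Lemma bounded_mfunM f g : bounded_mfun f -> bounded_mfun g ->
  bounded_mfun (fun x => f x * g x).
Proof.
move=> [mf [M fM]] [mg [N gN]]; split; first exact: measurable_funM.
by exists (M * N) => x; rewrite normrM ler_pM.
Qed.

Lemma bounded_mfunZ c f : bounded_mfun f -> bounded_mfun (fun x => c * f x).
Proof. by move=> bf; apply: bounded_mfunM => //; exact: bounded_mfun_cst. Qed.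

Lemma bounded_mfunB f g : bounded_mfun f -> bounded_mfun g ->
  bounded_mfun (fun x => f x - g x).
Proof.
move=> bf bg; have := bounded_mfunD bf (bounded_mfunZ (-1) bg).
by under eq_fun do rewrite mulN1r.
Qed.

Lemma bounded_mfun_sum I (s : seq I) (F : I -> T -> R) :
  (forall i, bounded_mfun (F i)) -> bounded_mfun (fun x => \sum_(i <- s) F i x).
Proof.
move=> bF; elim: s => [|i s IH].
  by under eq_fun do rewrite big_nil; exact: bounded_mfun_cst.
by under eq_fun do rewrite big_cons; exact: bounded_mfunD.
Qed.

Lemma bounded_mfun_indic (A : set T) : measurable A -> bounded_mfun (\1_A).
Proof.
move=> mA; split; first exact: measurable_indic.
by exists 1 => x; rewrite indicE; case: (_ \in _); rewrite ?normr0 ?normr1.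
Qed.

Lemma bounded_integrable f : bounded_mfun f -> P.-integrable setT (EFin \o f).
Proof.
move=> [mf [M fM]]; apply: measurable_bounded_integrable => //.
  exact: le_lt_trans (probability_le1 P measurableT) (ltry _).
exists M; split; first exact: num_real.
by move=> N MN x _; apply: le_trans (fM x) _; exact: ltW.
Qed.

Lemma eq_expect f g : f =1 g -> expect f = expect g.
Proof. by move=> /funext ->. Qed.

Lemma expect_cst c : expect (cst c) = c.
Proof. by rewrite /expect Rintegral_cst// [X in fine X]probability_setT mulr1. Qed.

Lemma expectD f g : bounded_mfun f -> bounded_mfun g ->
  expect (fun x => f x + g x) = expect f + expect g.
Proof. by move=> bf bg; rewrite /expect RintegralD//; exact: bounded_integrable. Qed.

Lemma expectB f g : bounded_mfun f -> bounded_mfun g ->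
  expect (fun x => f x - g x) = expect f - expect g.
Proof. by move=> bf bg; rewrite /expect RintegralB//; exact: bounded_integrable. Qed.

Lemma expectZ c f : bounded_mfun f -> expect (fun x => c * f x) = c * expect f.
Proof. by move=> bf; rewrite /expect RintegralZl//; exact: bounded_integrable. Qed.

Lemma expect_sum I (s : seq I) (F : I -> T -> R) :
  (forall i, bounded_mfun (F i)) ->
  expect (fun x => \sum_(i <- s) F i x) = \sum_(i <- s) expect (F i).
Proof.
move=> bF; elim: s => [|i s IH].
  by rewrite big_nil; under eq_fun do rewrite big_nil; exact: expect_cst.
rewrite big_cons -IH -expectD//; last exact: bounded_mfun_sum.
by apply: eq_expect => x; rewrite big_cons.
Qed.

Lemma expect_indic (A : set T) : measurable A -> (expect (\1_A))%:E = P A.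
Proof.
move=> mA; rewrite /expect /Rintegral integral_indic// setIT fineK//.
exact: fin_num_measure.
Qed.

Lemma expect_sqr_eq0 f : bounded_mfun f -> expect (fun x => f x * f x) = 0 ->
  f = cst 0 %[ae P].
Proof.
move=> bf; have bff := bounded_mfunM bf bf.
rewrite /expect /Rintegral => e0.
have i0 : (\int[P]_x (f x * f x)%:E = 0)%E.
  have := bounded_integrable bff => /integrable_fin_num -/(_ measurableT) fi.
  by rewrite -(fineK fi) e0.
have : (\int[P]_x `|(f x * f x)%:E| = 0)%E.
  rewrite -i0; apply: eq_integral => x _.
  by rewrite abse_EFin ger0_norm// -expr2 sqr_ge0.
move/ae_eq_integral_abs => /(_ measurableT) H.
have : ae_eq P setT (EFin \o (fun x => f x * f x)) (cst 0%E).
  by apply: H; apply/measurable_EFinP; exact: bff.1.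
by apply: filterS => x /(_ I)/= [] /eqP; rewrite mulf_eq0 orbb => /eqP.
Qed.

End bounded_functions.
(** * Averages over a cube and independence of the coordinates *)

(** Rectangles determine a measure on a product, so this is how every map into a
product is shown below to preserve measure. *)
Lemma product_prob_pushforward d (T : measurableType d) (R : realType)
    (P : probability T R) (I : choiceType) (n_ : I -> nat)
    (Q : probability (cube_prod n_) R) (psi : T -> cube_prod n_) :
  is_product_prob Q -> measurable_fun [set: T] psi ->
  (forall (J : {fset I}) (A : forall i, set (cube (n_ i))),
    P [set x | forall i, i \in J -> A i (psi x i)] =
    (\prod_(i <- J) cube_prob R (n_ i) (A i))%E) ->
  measure_preserving P Q psi.
Proof.
move=> HQ mpsi rect; split=> // A mA.
pose X : {mfun T >-> cube_prod n_} :=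
  HB.pack psi (isMeasurableFun.Build _ _ _ _ psi mpsi).
have HX : is_product_prob (distribution P X) by [].
exact: (product_prob_unique HX HQ).
Qed.

Lemma expect_comp d d' (T : measurableType d) (U : measurableType d')
    (R : realType) (P : probability T R) (Q : probability U R) (psi : T -> U)
    (f : U -> R) :
  measure_preserving P Q psi -> bounded_mfun f ->
  expect P (f \o psi) = expect Q f.
Proof.
move=> [mpsi psiP] bf; have [mf [M fM]] := bf.
rewrite /expect /Rintegral; congr fine.
rewrite -[LHS](@integral_pushforward _ _ _ _ _ psi mpsi P setT (EFin \o f))//.
- by apply: eq_measure_integral => A mA _; exact: psiP.
- exact/measurable_EFinP.
- rewrite preimage_setT; apply: (@bounded_integrable _ _ _ P (f \o psi)).
  split; first exact: measurableT_comp.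
  by exists M => x; exact: fM.
Qed.

Section averages.
Variable R : realType.

Definition average n (h : cube n -> R) : R := (\sum_u h u) / #|{: cube n}|%:R.

Lemma card_cube_neq0 n : #|{: cube n}|%:R != 0 :> R.
Proof. by rewrite pnatr_eq0 -lt0n card_cube_gt0. Qed.

Lemma average_cst n c : average (fun _ : cube n => c) = c.
Proof.
rewrite /average sumr_const -[c *+ _]mulr_natr mulfK//; exact: card_cube_neq0.
Qed.

Lemma averageB n (h g : cube n -> R) :
  average (fun u => h u - g u) = average h - average g.
Proof. by rewrite /average sumrB mulrBl. Qed.

Lemma average_sqr_eq0 n (h : cube n -> R) :
  average (fun u => h u * h u) = 0 -> forall u, h u = 0.
Proof.
move=> /eqP; rewrite mulf_eq0 invr_eq0 (negbTE (card_cube_neq0 n)) orbF.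
rewrite psumr_eq0 => [|u _]; last by rewrite -expr2 sqr_ge0.
move=> /allP h0 u; have /implyP/(_ isT) := h0 u (mem_index_enum u).
by rewrite mulf_eq0 orbb => /eqP.
Qed.

Lemma cube_prob_average n (A : set (cube n)) :
  cube_prob R n A = (average (\1_A))%:E.
Proof.
rewrite cube_probE /average; congr ((_ / _)%:E).
rewrite -sum1_card natr_sum big_mkcond/=; apply: eq_bigr => u _.
by rewrite indicE inE; case: (u \in A).
Qed.

Lemma cube_prob1 n (u : cube n) :
  cube_prob R n [set u] = (#|{: cube n}|%:R^-1)%:E.
Proof.
rewrite cube_prob_average /average (bigD1 u)//= big1 => [|v vu].
  by rewrite indicE mem_set// addr0 mul1r.
by rewrite indicE memNset// => /= /eqP; rewrite (negbTE vu).
Qed.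

End averages.

Section translations.
Variable R : realType.
Local Notation P := (Omega_prob R).

(** The cube as the group (Z/2)^(n+1); its translations preserve the measure and
act transitively, so averaging over them integrates a coordinate out. *)
Definition cube_add n (c u : cube n) : cube n := [ffun i => c i (+) u i].

Lemma cube_addC n (c u : cube n) : cube_add c u = cube_add u c.
Proof. by apply/ffunP => i; rewrite !ffunE addbC. Qed.

Lemma cube_addK n (c : cube n) : involutive (cube_add c).
Proof. by move=> u; apply/ffunP => i; rewrite !ffunE addbA addbb. Qed.

Lemma cube_add0 n (u : cube n) : cube_add point u = u.
Proof. by apply/ffunP => i; rewrite !ffunE. Qed.

Definition Omega_add (c x : Omega) : Omega := fun n => cube_add (c n) (x n).

Lemma average_cube_add n (c : cube n) (h : cube n -> R) :
  average (fun u => h (cube_add c u)) = average h.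
Proof.
rewrite /average; congr (_ / _).
by rewrite [RHS](reindex_inj (inv_inj (@cube_addK n c))).
Qed.

Lemma Omega_rectangle (J : {fset nat}) (A : forall n, set (cube n)) :
  P [set x | forall n, n \in J -> A n (x n)] =
  (\prod_(n <- J) cube_prob R n (A n))%E.
Proof. exact: (product_probP R (@inj_id nat)). Qed.

Lemma Omega_add_preserving c : measure_preserving P P (Omega_add c).
Proof.
apply: product_prob_pushforward; first exact: product_probP.
  apply: measurable_fun_cube_prod => n.
  exact: (measurableT_comp (f := cube_add (c n)) _
    (@measurable_coord _ (@idfun nat) n)).
move=> J A; have := Omega_rectangle J (fun n => cube_add (c n) @^-1` A n).
move=> ->; apply: eq_bigr => n _; rewrite !cube_prob_average; congr EFin.
exact: (average_cube_add (c n) (\1_(A n))).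
Qed.

(** Besides being the translation that moves only the coordinate k, this extends
a point of the cube k to a point of [Omega]. Reading it off at an index merely
equal to k then replaces a cast between cubes ([single_coordE]). *)
Definition single_coord k (a : cube k) : Omega :=
  eqtype.dfwith (fun n => point : cube n) a.

Lemma single_coord_in k (a : cube k) : single_coord a k = a.
Proof. exact: dfwith_in. Qed.

Lemma single_coord_out k (a : cube k) n : k != n -> single_coord a n = point.
Proof. by move=> kn; rewrite /single_coord dfwith_out. Qed.

(** Independence of the coordinate k, in the form of an invariance that integrals
can exploit directly. *)
Definition coord_free k (F : Omega -> R) :=
  forall (a : cube k) x, F (Omega_add (single_coord a) x) = F x.

Lemma coord_free_coord k n (h : cube n -> R) :
  k != n -> coord_free k (fun x => h (x n)).
Proof.
by move=> kn a x; rewrite /Omega_add single_coord_out// cube_add0.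
Qed.

Lemma coord_free_cst k c : coord_free k (cst c).
Proof. by []. Qed.

Lemma coord_freeM k F G :
  coord_free k F -> coord_free k G -> coord_free k (fun x => F x * G x).
Proof. by move=> hF hG a x; rewrite hF hG. Qed.

Lemma bounded_coord n (h : cube n -> R) :
  bounded_mfun (fun x : Omega => h (x n)).
Proof.
split; first exact: (measurableT_comp _ (@measurable_coord _ (@idfun nat) n)).
exists (\sum_u `|h u|) => x.
by rewrite (bigD1 (x n))//= lerDl sumr_ge0.
Qed.

(** Averaging the integral over all translations of the coordinate k leaves F
alone and replaces h by its average. All uses of independence rest on this
computation. *)
Lemma expect_coord_free k (h : cube k -> R) F : bounded_mfun F ->
  coord_free k F ->
  expect P (fun x => h (x k) * F x) = average h * expect P F.
Proof.
move=> bF Fk.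
have step (a : cube k) : expect P (fun x => h (x k) * F x) =
    expect P (fun x => h (cube_add a (x k)) * F x).
  rewrite -(expect_comp (Omega_add_preserving (single_coord a))); last first.
    by apply: bounded_mfunM => //; exact: bounded_coord.
  apply: eq_expect => x /=.
  by rewrite Fk {1}/Omega_add single_coord_in.
have : \sum_(a : cube k) expect P (fun x => h (x k) * F x) =
    (\sum_u h u) * expect P F.
  rewrite (eq_bigr _ (fun a _ => step a)).
  rewrite -expect_sum => [|a]; last first.
    apply: bounded_mfunM => //.
    exact: (bounded_coord (fun u => h (cube_add a u))).
  rewrite -expectZ//; apply: eq_expect => x.
  rewrite -mulr_suml; congr (_ * _).
  under eq_bigr do rewrite cube_addC.
  by rewrite [RHS](reindex_inj (inv_inj (@cube_addK _ (x k)))).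
rewrite sumr_const -mulr_natl /average => H.
rewrite mulrAC -H mulrAC mulfV ?mul1r//; exact: card_cube_neq0.
Qed.

Lemma expect_coord k (h : cube k -> R) :
  expect P (fun x => h (x k)) = average h.
Proof.
have := @expect_coord_free k h _ (bounded_mfun_cst _ 1) (@coord_free_cst k 1).
by rewrite expect_cst mulr1 => <-; apply: eq_expect => x; rewrite mulr1.
Qed.

(** The index type is arbitrary so that the lemma also applies to the subfamily
of coordinates in a fibre. *)
Lemma expect_prod_coord (I : choiceType) (n_ : I -> nat) (s : seq I)
    (h : forall i, cube (n_ i) -> R) :
  injective n_ -> uniq s ->
  bounded_mfun (fun x : Omega => \prod_(i <- s) h i (x (n_ i))) /\
  expect P (fun x => \prod_(i <- s) h i (x (n_ i))) =
    \prod_(i <- s) average (h i).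
Proof.
move=> n_inj; elim: s => [_|i s IH /= /andP[iNs /IH[bs Es]]].
  split; first by under eq_fun do rewrite big_nil; exact: bounded_mfun_cst.
  by rewrite big_nil; under eq_fun do rewrite big_nil; exact: expect_cst.
split.
  under eq_fun do rewrite big_cons.
  by apply: bounded_mfunM => //; exact: bounded_coord.
rewrite big_cons -Es -expect_coord_free//.
  by apply: eq_expect => x; rewrite big_cons.
move=> a x; rewrite big_seq [RHS]big_seq; apply: eq_bigr => j js.
apply: (@coord_free_coord _ _ (h j)).
by apply: contraNneq iNs => /n_inj ->.
Qed.

Lemma measurable_coord_set n (A : set (cube n)) :
  measurable [set x : Omega | A (x n)].
Proof.
rewrite -[X in measurable X]setTI.
exact: (measurable_coord (n_ := @idfun nat)).
Qed.

Lemma Omega_prob_coord n (A : set (cube n)) :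
  P [set x | A (x n)] = cube_prob R n A.
Proof.
rewrite -expect_indic; last exact: measurable_coord_set.
by rewrite cube_prob_average -expect_coord.
Qed.

Lemma Omega_prob_rectangle (I : choiceType) (n_ : I -> nat) (s : seq I)
    (A : forall i, set (cube (n_ i))) : injective n_ -> uniq s ->
  P [set x | forall i, i \in s -> A i (x (n_ i))] =
  (\prod_(i <- s) cube_prob R (n_ i) (A i))%E.
Proof.
move=> n_inj us.
have [_ E] := expect_prod_coord (fun i => \1_(A i)) n_inj us.
under eq_bigr do rewrite cube_prob_average.
rewrite prodEFin -E -expect_indic.
  congr EFin; apply: eq_expect => x; rewrite indicE.
  have [/set_mem xA|/negP xA] := boolP (x \in _).
    by rewrite big_seq big1// => i si; rewrite indicE mem_set//; exact: xA.
  have [i [si Ai]] : exists i, i \in s /\ ~ A i (x (n_ i)).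
    apply: contrapT => /forallNP H; apply: xA; apply/mem_set => i si.
    by apply: contrapT => Ai; apply: (H i).
  by rewrite (big_rem i)//= indicE memNset// mul0r.
rewrite (_ : [set x | _] =
    \bigcap_(i in [set` s]) [set x : Omega | A i (x (n_ i))]).
  by apply: fin_bigcap_measurable => // i _; exact: measurable_coord_set.
by apply/seteqP; split => x /= h i; exact: h.
Qed.

End translations.
(** * Two-valued elements depend on one coordinate *)

Section two_valued.
Variable R : realType.
Local Notation P := (Omega_prob R).
Local Notation E := (expect P).

Definition orth_coords (F : Omega -> R) : Prop :=
  forall n (h : cube n -> R), average h = 0 -> E (fun x => h (x n) * F x) = 0.

(** What remains of the membership in X_omega when it is tested only against
bounded functions; unlike a series expansion, it passes to limits at once. *)
Definition weakly_additive (Y : Omega -> R) : Prop :=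
  forall F, bounded_mfun F -> orth_coords F -> E (fun x => Y x * F x) = 0.

(** The conditional expectation of Y given that the k-th coordinate is u; the
factor is the inverse of the probability of that event. *)
Definition coord_mean k (Y : Omega -> R) (u : cube k) : R :=
  #|{: cube k}|%:R * E (fun x => (x k == u)%:R * Y x).

Lemma expect_coord_mean k (h : cube k -> R) Y : bounded_mfun Y ->
  E (fun x => h (x k) * Y x) = average (fun u => h u * coord_mean Y u).
Proof.
move=> bY.
have bY1 u : bounded_mfun (fun x : Omega => (x k == u)%:R * Y x).
  by apply: bounded_mfunM => //; exact: (bounded_coord (fun v => (v == u)%:R)).
rewrite /average /coord_mean mulr_suml.
transitivity (E (fun x => \sum_u h u * ((x k == u)%:R * Y x))).
  apply: eq_expect => x; rewrite (bigD1 (x k))//= eqxx mul1r big1 ?addr0//.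
  by move=> u ux; rewrite eq_sym (negbTE ux) mul0r mulr0.
rewrite expect_sum; last by move=> u; exact: bounded_mfunZ.
apply: eq_bigr => u _; rewrite expectZ//.
by rewrite [in RHS]mulrCA [RHS]mulrC mulKf//; exact: card_cube_neq0.
Qed.

Lemma expect_coord_pair k l (h : cube k -> R) (g : cube l -> R) : k != l ->
  E (fun x => h (x k) * g (x l)) = average h * average g.
Proof.
move=> kl; rewrite (expect_coord_free h (bounded_coord g)) ?expect_coord//.
exact: coord_free_coord.
Qed.

Variables (Y : Omega -> R) (a b : R).
Hypotheses (bY : bounded_mfun Y) (wY : weakly_additive Y).
Hypothesis Yab : forall x, (Y x - a) * (Y x - b) = 0.

Let y k : cube k -> R := @coord_mean k Y.
Let v k : R := average (fun u : cube k => y u * y u).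

Ltac bdd := repeat first
  [ assumption | exact: bounded_mfun_cst | apply: bounded_coord
  | apply: bounded_mfunZ | apply: bounded_mfunM | apply: bounded_mfunB
  | apply: bounded_mfunD ].

Let average_y k : average (@y k) = 0.
Proof.
have <- : E (fun x => Y x * cst 1 x) = 0.
  apply: wY; first exact: bounded_mfun_cst.
  move=> n h h0; rewrite -[RHS]h0 -expect_coord.
  by apply: eq_expect => x; rewrite mulr1.
transitivity (average (fun u => 1 * @y k u)).
  by congr average; apply/funext => u; rewrite mul1r.
rewrite -(expect_coord_mean (fun=> 1) bY).
by apply: eq_expect => x; rewrite mulrC.
Qed.

(** A product of two centered functions of distinct coordinates is orthogonal to
every function h of one coordinate: one of its factors is independent of h. *)
Let expect_Y_pair k l (f : cube k -> R) (g : cube l -> R) : k != l ->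
  average f = 0 -> average g = 0 -> E (fun x => Y x * (f (x k) * g (x l))) = 0.
Proof.
move=> kl f0 g0; apply: wY => [|n h h0]; first by bdd.
have [nk|nk] := eqVneq k n.
  subst n; transitivity (E (fun x => (fun u => h u * f u) (x k) * g (x l))).
    by apply: eq_expect => x; rewrite mulrA.
  by rewrite (expect_coord_pair (fun u => h u * f u) g kl) g0 mulr0.
transitivity (E (fun x => f (x k) * (h (x n) * g (x l)))).
  by apply: eq_expect => x; rewrite mulrCA.
rewrite expect_coord_free ?f0 ?mul0r//; first by bdd.
by apply: coord_freeM; exact: coord_free_coord.
Qed.

(** With three coordinates, at least two factors remain independent of h. *)
Let expect_Y_triple n k l (e : cube n -> R) (f : cube k -> R) (g : cube l -> R) :
  n != k -> n != l -> k != l ->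
  average e = 0 -> average f = 0 -> average g = 0 ->
  E (fun x => Y x * (e (x n) * (f (x k) * g (x l)))) = 0.
Proof.
move=> nk nl kl e0 f0 g0; apply: wY => [|m h h0]; first by bdd.
have [mn|mn] := eqVneq n m.
  subst m.
  transitivity (E (fun x => f (x k) * ((fun u => h u * e u) (x n) * g (x l)))).
    by apply: eq_expect => x /=; ring.
  rewrite expect_coord_free ?f0 ?mul0r//; first by bdd.
  apply: coord_freeM; [apply: (@coord_free_coord _ k n (fun u => h u * e u))|];
    by [rewrite eq_sym|exact: coord_free_coord].
transitivity (E (fun x => e (x n) * (h (x m) * (f (x k) * g (x l))))).
  by apply: eq_expect => x; rewrite mulrCA.
rewrite expect_coord_free ?e0 ?mul0r//; first by bdd.
by apply: coord_freeM; [|apply: coord_freeM]; exact: coord_free_coord.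
Qed.

(** For n = k the factor h y_k is not centered; subtracting its mean c leaves a
pair term, which vanishes, and c E(Y y_l) = c E(y_l^2). *)
Let expect_Y_mixed k l n (h : cube n -> R) : k != l -> n != l ->
  average h = 0 ->
  E (fun x => Y x * (h (x n) * (y (x k) * y (x l)))) =
  v l * E (fun x => h (x n) * y (x k)).
Proof.
move=> kl nl h0; have [nk|nk] := eqVneq n k; last first.
  rewrite expect_Y_triple//; try exact: average_y.
  by rewrite expect_coord_pair// h0 mul0r mulr0.
subst n; set c := average (fun u => h u * y u).
rewrite -[E (fun x => h (x k) * _)]/(E (fun x => (fun u => h u * y u) (x k))).
rewrite expect_coord -/c.
transitivity (E (fun x => Y x * ((fun u => h u * y u - c) (x k) * y (x l)) +
    c * (y (x l) * Y x))).
  by apply: eq_expect => x /=; ring.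
rewrite expectD; first last.
- by bdd.
- by bdd; exact: (bounded_coord (fun u => h u * y u - c)).
rewrite (expect_Y_pair (f := fun u => h u * y u - c) kl); first last.
- exact: average_y.
- by rewrite averageB average_cst subrr.
- rewrite add0r expectZ; last by bdd.
  by rewrite expect_coord_mean// mulrC.
Qed.

(** The test function F is Y y_k y_l corrected so as to become orthogonal to all
functions of one coordinate. Pairing it with Y and replacing Y^2 by its affine
expression in Y leaves -2 E(y_k^2) E(y_l^2) = 0. *)
Let v_mul_eq0 k l : k != l -> v k * v l = 0.
Proof.
move=> kl; have lk : l != k by rewrite eq_sym.
pose F x : R := Y x * (y (x k) * y (x l)) - (v l * y (x k) + v k * y (x l)).
have bF : bounded_mfun F by rewrite /F; bdd.
have oF : orth_coords F.
  move=> n h h0.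
  transitivity (E (fun x => Y x * (h (x n) * (y (x k) * y (x l))) -
     (v l * (h (x n) * y (x k)) + v k * (h (x n) * y (x l))))).
    by apply: eq_expect => x; rewrite /F; ring.
  rewrite expectB; [|by bdd|by bdd].
  rewrite expectD; [|by bdd|by bdd].
  rewrite !expectZ; [|by bdd|by bdd].
  have [nl|nl] := eqVneq n l.
    subst n; rewrite (_ : E (fun x => _ * (_ * _)) =
        E (fun x => Y x * (h (x l) * (y (x l) * y (x k))))); last first.
      by apply: eq_expect => x; rewrite (mulrC (y (x k))).
    rewrite expect_Y_mixed// (expect_coord_pair h (@y k) lk) h0 mul0r mulr0 add0r.
    by rewrite subrr.
  rewrite expect_Y_mixed// (expect_coord_pair h (@y l) nl).
  by rewrite h0 mul0r mulr0 addr0 subrr.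
have := wY bF oF.
have -> : E (fun x => Y x * F x) = E (fun x =>
    ((a + b) * (Y x * (y (x k) * y (x l))) - (a * b) * (y (x k) * y (x l))) -
    (v l * (y (x k) * Y x) + v k * (y (x l) * Y x))).
  apply: eq_expect => x; have YY : Y x * Y x = (a + b) * Y x - a * b.
    by have := Yab x; nra.
  rewrite /F; transitivity (Y x * Y x * (y (x k) * y (x l)) -
    Y x * (v l * y (x k) + v k * y (x l))); first by ring.
  by rewrite YY; ring.
rewrite expectB; [|by bdd|by bdd].
rewrite expectB; [|by bdd|by bdd].
rewrite expectD; [|by bdd|by bdd].
rewrite !expectZ; [|by bdd..].
rewrite expect_Y_pair//; try exact: average_y.
rewrite expect_coord_pair// average_y !mul0r !mulr0 subrr sub0r.
rewrite !expect_coord_mean// -/(v k) -/(v l) => /eqP.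
rewrite oppr_eq0 (mulrC (v l)) -mulr2n mulrn_eq0 => /orP[//|/eqP //].
Qed.

Lemma two_valued_coord :
  exists k (g : cube k -> R), Y = (fun x => g (x k)) %[ae P].
Proof.
have [k yl0] : exists k, forall l, k != l -> forall u : cube l, y u = 0.
  have [[k vk]|/forallNP v0] := pselect (exists k, v k <> 0).
    exists k => l /v_mul_eq0 /eqP; rewrite mulf_eq0 => /orP[/eqP //|/eqP].
    exact: average_sqr_eq0.
  by exists 0%N => l _; apply: average_sqr_eq0; exact: contrapT (v0 l).
exists k, (@y k).
(* Z is orthogonal to the functions of one coordinate and to y_k, hence to
   Z = Y - y_k. *)
pose Z x := Y x - y (x k).
have bZ : bounded_mfun Z by rewrite /Z; bdd.
have oZ' n (h : cube n -> R) : average h = 0 \/ n = k ->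
    E (fun x => h (x n) * Z x) = 0.
  move=> hn; transitivity (E (fun x => h (x n) * Y x - h (x n) * y (x k))).
    by apply: eq_expect => x; rewrite mulrBr.
  rewrite expectB; [|by bdd|by bdd].
  rewrite expect_coord_mean//.
  have [nk|nk] := eqVneq n k.
    subst n.
    rewrite -[X in _ - X]/(E (fun x => (fun u => h u * y u) (x k))).
    by rewrite expect_coord subrr.
  case: hn => [h0|/eqP]; last by rewrite (negbTE nk).
  rewrite expect_coord_pair// h0 mul0r subr0.
  have y0 := yl0 n; rewrite eq_sym in y0.
  rewrite (_ : (fun u => _) = (fun=> 0)) ?average_cst//.
  by apply/funext => u; rewrite -/(y u) y0// mulr0.
have oZ : orth_coords Z by move=> n h h0; apply: oZ'; left.
have : E (fun x => Z x * Z x) = 0.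
  transitivity (E (fun x => Y x * Z x - y (x k) * Z x)).
    by apply: eq_expect => x; rewrite /Z; ring.
  rewrite expectB; [|by bdd|by bdd].
  by rewrite wY// oZ' ?subrr//; right.
move/(expect_sqr_eq0 bZ); apply: filterS => x /= Zx _.
by apply/eqP; rewrite -subr_eq0; apply/eqP; exact: Zx.
Qed.

End two_valued.
(** * The space X_omega *)

Section almost_everywhere_equality.
Context d (T : measurableType d) (R : realType) (P : probability T R).

Lemma ae_eq_map U V (f g : T -> U) (f' g' : T -> V) :
  (forall x, f x = g x -> f' x = g' x) -> f = g %[ae P] -> f' = g' %[ae P].
Proof. by move=> H; apply: filterS => x fg xT; apply: H; exact: fg. Qed.

Lemma ae_eq_map2 U1 U2 V (f1 g1 : T -> U1) (f2 g2 : T -> U2) (f' g' : T -> V) :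
  (forall x, f1 x = g1 x -> f2 x = g2 x -> f' x = g' x) ->
  f1 = g1 %[ae P] -> f2 = g2 %[ae P] -> f' = g' %[ae P].
Proof.
by move=> H; apply: filterS2 => x fg1 fg2 xT; apply: H; [exact: fg1|exact: fg2].
Qed.

End almost_everywhere_equality.

Section Lp_norm.
Context d (T : measurableType d) (R : realType) (P : probability T R).
Variables (p : R) (p1 : 1 < p).
Local Notation Lp := (LfunType P (lt1_le1E p1)).
Local Notation "'N[ f ]" := (Lnorm P p%:E (EFin \o f%R)).

Lemma LfunDE (f g : Lp) x : (f + g) x = f x + g x. Proof. by []. Qed.
Lemma LfunBE (f g : Lp) x : (f - g) x = f x - g x. Proof. by []. Qed.
Lemma LfunZE c (f : Lp) x : (c *: f) x = c * f x. Proof. by []. Qed.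
Lemma Lfun_sumE I (s : seq I) (F : I -> Lp) x :
  (\sum_(i <- s) F i) x = \sum_(i <- s) F i x.
Proof.
by elim: s => [|i s IH]; rewrite ?big_nil// !big_cons -IH LfunDE.
Qed.

Lemma Lfun_ext (f g : Lp) : (forall x, f x = g x) -> f = g.
Proof. by move=> fg; apply/LfuneqP => x; exact: fg. Qed.

Lemma measurable_Lfun (f : Lp) : measurable_fun [set: T] f.
Proof. exact: measurable_funPT. Qed.

(** Hoelder's inequality against the constant 1, on a probability space. *)
Lemma integral_abs_le_Lnorm (f : Lp) :
  (\int[P]_x `|(f x)%:E| <= 'N[f])%E.
Proof.
have p0 : 0 < p by exact: lt_trans p1.
pose q := (1 - p^-1)^-1.
have q0 : 0 < q by rewrite invr_gt0 subr_gt0 invf_lt1.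
have pq : p^-1 + q^-1 = 1 by rewrite invrK addrC subrK.
have := hoelder P (measurable_Lfun f) (@measurable_cst _ _ _ _ setT (1 : R))
  p0 q0 pq.
rewrite Lnorm_cst1 [X in (X `^ _)%E](@probability_setT _ _ _ P).
rewrite poweR1r mule1 Lnorm1.
by apply: le_trans; rewrite le_eqVlt; apply/orP; left; apply/eqP;
  apply: eq_integral => x _ /=; rewrite mulr1.
Qed.

Lemma Lnorm_triangle (f g h : Lp) :
  ('N[f - h] <= 'N[f - g] + 'N[g - h])%E.
Proof.
rewrite (_ : f - h = (f - g) + (g - h)); last by rewrite addrA subrK.
by apply: eminkowski; [exact: measurable_Lfun..|exact: lt1_le1E].
Qed.

Lemma Lnorm_subC (f g : Lp) : 'N[f - g] = 'N[g - f].
Proof.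
rewrite -oppe_Lnorm; apply: eq_Lnorm => x /=.
by change ((- (f x - g x))%:E = (g x - f x)%:E); rewrite opprB.
Qed.

Lemma Lnorm_ae_eq (f g : Lp) : f = g %[ae P] -> 'N[f] = 'N[g].
Proof.
move=> fg; rewrite unlock /Lnorm; congr (_ `^ _)%E.
apply: ge0_ae_eq_integral => //.
- by apply/measurable_EFinP/(@measurableT_comp _ _ _ _ _ _ (@powR R ^~ p));
    [|exact: measurableT_comp].
- by apply/measurable_EFinP/(@measurableT_comp _ _ _ _ _ _ (@powR R ^~ p));
    [|exact: measurableT_comp].
- by move=> x _; exact: poweR_ge0.
- by move=> x _; exact: poweR_ge0.
by move: fg; apply: ae_eq_map => x /= ->.
Qed.

Lemma Lnorm_small_ae_eq (f g : Lp) :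
  (forall e : R, 0 < e -> ('N[f - g] <= e%:E)%E) -> f = g %[ae P].
Proof.
move=> fg0.
have : 'N[f - g] = 0%E.
  apply/eqP; rewrite eq_le Lnorm_ge0 andbT.
  by apply/lee_addgt0Pr => e e0; rewrite add0e; exact: fg0.
have m : measurable_fun setT (EFin \o (f - g)).
  by apply/measurable_EFinP; exact: measurable_Lfun.
move=> /(Lnorm_eq0_eq0 m) H; have := H (lt_trans (@ltr01 R) p1).
apply: filterS => x /= /(_ I) [] /eqP; rewrite subr_eq0 => /eqP fgx _.
exact: fgx.
Qed.

End Lp_norm.

Section X_omega_functions.
Variables (R : realType) (p : R) (p1 : 1 < p).
Local Notation P := (Omega_prob R).
Local Notation E := (expect P).
Local Notation Lp := (LfunType P (lt1_le1E p1)).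
Local Notation X := (X_omega (lt1_le1E p1)).

(** The integral over the cube is the average, seen through the coordinate n of
[Omega], where both are already known. *)
Lemma mean_zeroE n (h : LfunType (cube_prob R n) (lt1_le1E p1)) :
  mean_zero (lt1_le1E p1) n h <-> average h = 0.
Proof.
rewrite /mean_zero /=.
have -> : (\int[cube_prob R n]_x (h x)%:E)%E = (average h)%:E.
  rewrite -expect_coord /expect /Rintegral fineK; last first.
    apply: integrable_fin_num => //; apply: bounded_integrable.
    exact: bounded_coord.
  have mc := @measurable_coord _ (@idfun nat) n.
  rewrite -[RHS](@integral_pushforward _ _ _ _ _ _ mc P setT (EFin \o h))//.
    apply: eq_measure_integral => A mA _; apply/esym.
    exact: Omega_prob_coord.
  rewrite preimage_setT; apply: (bounded_integrable P (bounded_coord h)).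
by split=> [[]|->].
Qed.

Local Notation generators :=
  (\bigcup_n (@coord_embed R p (lt1_le1E p1) n @` @mean_zero R p (lt1_le1E p1) n)).

Lemma span_bounded (g : Lp) : linear_span generators g -> bounded_mfun g.
Proof.
move=> [m [c [s [sG ->]]]].
rewrite (_ : (\sum_(i < m) c i *: s i : Lp) =
    (fun x => \sum_(i < m) c i * s i x) :> (_ -> _)); last first.
  by apply/funext => x; rewrite Lfun_sumE.
apply: bounded_mfun_sum => i; apply: bounded_mfunZ.
have [n _ [h _ <-]] := sG i; exact: bounded_coord.
Qed.

Lemma span_orth (g : Lp) F : linear_span generators g -> bounded_mfun F ->
  orth_coords F -> E (fun x => g x * F x) = 0.
Proof.
move=> [m [c [s [sG ->]]]] bF oF.
transitivity (E (fun x => \sum_(i < m) c i * (s i x * F x))).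
  apply: eq_expect => x; rewrite Lfun_sumE mulr_suml.
  by apply: eq_bigr => i _; rewrite LfunZE mulrA.
have bs i : bounded_mfun (s i).
  by have [n _ [h _ <-]] := sG i; exact: bounded_coord.
rewrite expect_sum => [|i]; last by apply: bounded_mfunZ; exact: bounded_mfunM.
rewrite big1// => i _; rewrite expectZ; last exact: bounded_mfunM.
have [n _ [h /mean_zeroE h0 <-]] := sG i.
by rewrite [E _](oF n h h0) mulr0.
Qed.

(** Elements of the span annihilate F, and a bounded F is continuous for the L^1
norm, hence for the L^p norm. The function Y is a bounded representative of the
class of f. *)
Lemma X_omega_weakly_additive (f : Lp) (Y : Omega -> R) :
  X f -> bounded_mfun Y -> f = Y %[ae P] -> weakly_additive Y.
Proof.
move=> Xf bY fY F bF oF.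
have [mF [M FM]] := bF.
have M0 : 0 <= M by exact: le_trans (FM point).
apply/eqP; rewrite -normr_le0; apply/ler_addgt0Pr => e e0; rewrite add0r.
have [|g Sg fg] := Xf (e / (M + 1)); first by rewrite divr_gt0// ltr_wpDl.
have bg := span_bounded Sg.
have -> : E (fun x => Y x * F x) = E (fun x => (Y x - g x) * F x).
  rewrite -[LHS]subr0 -(span_orth Sg bF oF) -expectB; try exact: bounded_mfunM.
  by apply: eq_expect => x; rewrite mulrBl.
have bYg := bounded_mfunB bY bg.
have bYgF := bounded_mfunM bYg bF.
rewrite -lee_fin.
have iF := bounded_integrable P bYgF.
have -> : (`|E (fun x => (Y x - g x) * F x)|%:E =
    `|\int[P]_x ((Y x - g x) * F x)%:E|)%E.
  rewrite -abse_EFin /expect /Rintegral fineK//.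
  exact: integrable_fin_num.
apply: le_trans (@le_abse_integral _ _ _ _ _ _ measurableT _) _.
  by apply/measurable_EFinP; exact: bYgF.1.
apply: (@le_trans _ _ (\int[P]_x (M%:E * `|((f - g) x)%:E|))%E).
  rewrite [leRHS](@ae_eq_integral _ _ _ _ _
      (fun x => M%:E * `|(Y x - g x)%:E|)%E _ measurableT)//.
  - apply: ge0_le_integral => //.
    + by apply: measurableT_comp => //; apply/measurable_EFinP; exact: bYgF.1.
    + apply: measurable_funeM; apply: measurableT_comp => //.
      by apply/measurable_EFinP; exact: bYg.1.
    + move=> x _; rewrite !abse_EFin -EFinM lee_fin normrM mulrC.
      by apply: ler_wpM2r.
  - apply: measurable_funeM; apply: measurableT_comp => //.
    by apply/measurable_EFinP; exact: measurable_Lfun.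
  - apply: measurable_funeM; apply: measurableT_comp => //.
    by apply/measurable_EFinP; exact: bYg.1.
  - by move: fY; apply: ae_eq_map => x fYx; rewrite LfunBE fYx.
rewrite ge0_integralZl//; last first.
  by apply: measurableT_comp => //; apply/measurable_EFinP; exact: measurable_Lfun.
apply: (@le_trans _ _ (M%:E * (e / (M + 1))%:E)%E).
  apply: lee_wpmul2l; rewrite ?lee_fin//.
  by apply: le_trans (integral_abs_le_Lnorm (f - g)) _; exact: ltW.
rewrite -EFinM lee_fin mulrCA ler_piMr//; first exact: ltW.
by rewrite ler_pdivrMr ?mul1r ?lerDl// ltr_wpDl.
Qed.

End X_omega_functions.
(** * Images of centered indicators *)

Section probability_ae.
Context d (T : measurableType d) (R : realType) (P : probability T R).

Lemma prob1_ae (S : set T) : measurable S -> P S = 1%E ->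
  {ae P, forall x, S x}.
Proof.
move=> mS PS; exists (~` S); split=> //; first exact: measurableC.
by rewrite probability_setC// PS subee.
Qed.

Lemma prob_ae_eq (A B : set T) : measurable A -> measurable B ->
  (\1_A : T -> R) = \1_B %[ae P] -> P A = P B.
Proof.
move=> mA mB AB.
have E (C : set T) : measurable C -> P C = (\int[P]_x (\1_C x)%:E)%E.
  by move=> mC; rewrite integral_indic// setIT.
rewrite !E//; apply: ge0_ae_eq_integral => //.
- by apply/measurable_EFinP; exact: measurable_indic.
- by apply/measurable_EFinP; exact: measurable_indic.
by move: AB; apply: ae_eq_map => x /= ->.
Qed.

Lemma prob_ae_eq_fun (U : Type) (f g : T -> U) (A : set U) :
  f = g %[ae P] -> measurable (f @^-1` A) -> measurable (g @^-1` A) ->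
  P (f @^-1` A) = P (g @^-1` A).
Proof.
move=> fg mf mg; apply: prob_ae_eq => //.
by move: fg; apply: ae_eq_map => x; rewrite !indicE => fgx; congr ((_ : bool)%:R);
  apply/idP/idP => /set_mem /= h; apply/mem_set => /=; [rewrite -fgx|rewrite fgx].
Qed.

End probability_ae.

(** Every point of a cube has positive probability. *)
Lemma coord_ae (R : realType) k (Q : set (cube k)) :
  {ae Omega_prob R, forall x, Q (x k)} -> forall u, Q u.
Proof.
move=> [N [mN N0 QN]] u; apply: contrapT => Qu.
have : (Omega_prob R [set x | [set u] (x k)] <= 0)%E.
  rewrite -N0; apply: le_measure; rewrite ?inE//.
    exact: measurable_coord_set.
  by move=> x /= xu; apply: QN => /=; rewrite xu.
rewrite Omega_prob_coord cube_prob1 lee_fin leNgt invr_gt0 ltr0n.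
by rewrite card_cube_gt0.
Qed.

Section operators.
Variables (R : realType) (p : R) (p1 : 1 < p).
Local Notation P := (Omega_prob R).
Local Notation Lp := (LfunType P (lt1_le1E p1)).
Local Notation cubeLp n := (LfunType (cube_prob R n) (lt1_le1E p1)).
Local Notation X := (X_omega (lt1_le1E p1)).
Local Notation generators :=
  (\bigcup_n (@coord_embed R p (lt1_le1E p1) n @` @mean_zero R p (lt1_le1E p1) n)).

Lemma Lp_closure_sub (S : set Lp) : S `<=` Lp_closure S.
Proof.
move=> f Sf e e0; exists f => //; rewrite subrr.
by rewrite (_ : EFin \o _ = cst 0%E)// Lnorm0 ?lte_fin// eqe gt_eqF// (lt_trans _ p1).
Qed.

Lemma span_sum I (s : seq I) (c : I -> R) (g : I -> Lp) :
  (forall i, generators (g i)) -> linear_span generators (\sum_(i <- s) c i *: g i).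
Proof.
move=> gG; rewrite big_tnth.
by exists (size s), (fun j => c (tnth (in_tuple s) j)),
  (fun j => g (tnth (in_tuple s) j)).
Qed.

Lemma span_sub (f g : Lp) :
  linear_span generators f -> linear_span generators g ->
  linear_span generators (f - g).
Proof.
move=> [m [c [s [sG ->]]]] [m' [c' [s' [s'G ->]]]].
pose u (i : 'I_m + 'I_m') := match i with inl i => s i | inr i => s' i end.
pose a (i : 'I_m + 'I_m') := match i with inl i => c i | inr i => - c' i end.
have := @span_sum _ (index_enum _) a u; rewrite big_sumType/=.
under [X in _ + X]eq_bigr do rewrite scaleNr.
by rewrite sumrN; apply => -[].
Qed.

Variable T : Lp -> Lp.
Hypothesis lT : bounded_linear_on X T.

(** Linearity holds for each sum only almost everywhere, hence the induction. *)
Lemma operator_sum I (s : seq I) (c : I -> R) (g : I -> Lp) :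
  (forall i, generators (g i)) ->
  T (\sum_(i <- s) c i *: g i) = \sum_(i <- s) c i *: T (g i) %[ae P].
Proof.
move=> gG; have [_ _ Tlin _] := lT.
have X_sum r : X (\sum_(i <- r) c i *: g i).
  by apply: Lp_closure_sub; exact: span_sum.
elim: s => [|i s IH].
  have X0 := X_sum [::]; have := Tlin (-1) _ _ X0 X0.
  rewrite !big_nil scaler0 addr0; apply: ae_eq_map => x ->.
  by rewrite scaleN1r addNr.
rewrite !big_cons.
have Xg : X (g i).
  have := span_sum [:: i] (fun=> 1) gG; rewrite big_seq1 scale1r.
  exact: Lp_closure_sub.
move: (Tlin (c i) _ _ Xg (X_sum s)) IH.
by apply: ae_eq_map2 => x -> IHx; rewrite !LfunDE IHx.
Qed.

Lemma generator_embed n (h : cubeLp n) :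
  average h = 0 -> generators (coord_embed h).
Proof. by move=> h0; exists n => //; exists h => //; apply/mean_zeroE. Qed.

(** The functions e_A; centered indicators are the two-valued elements of H_n. *)
Definition centered n (A : set (cube n)) : cubeLp n :=
  cube_Lp (lt1_le1E p1) (fun u => \1_A u - average (\1_A : cube n -> R)).

Lemma average_centered n (A : set (cube n)) : average (centered A) = 0.
Proof.
transitivity (average (fun u => \1_A u - average (\1_A : cube n -> R))) => //.
by rewrite averageB average_cst subrr.
Qed.

Lemma centeredE n (A : set (cube n)) (x : Omega) :
  coord_embed (centered A) x = \1_A (x n) - average (\1_A : cube n -> R).
Proof. by []. Qed.

Hypothesis dT : distributional_embedding T.

(** A sum of the functions 1_S - m_i is at most C, with equality exactly on the
intersection of the sets S. Comparing the probabilities of the value C for the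
sum and for its image compares those of the two intersections; so marginal
information on single images yields the joint law. *)
Lemma joint_law (I : choiceType) (s : seq I) (n_ : I -> nat)
    (A : forall i, set (cube (n_ i))) (S : I -> set Omega) :
  (forall i, measurable (S i)) ->
  (forall i, T (coord_embed (centered (A i))) =
     (fun x => \1_(S i) x - average (\1_(A i) : cube (n_ i) -> R)) %[ae P]) ->
  P [set x | forall i, i \in s -> S i x] =
  P [set x | forall i, i \in s -> A i (x (n_ i))].
Proof.
move=> mS TS; pose m i := average (\1_(A i) : cube (n_ i) -> R).
pose C : R := \sum_(i <- s) (1 - m i).
pose f : Lp := \sum_(i <- s) 1 *: coord_embed (centered (A i)).
have max (B : I -> set Omega) x :
    (\sum_(i <- s) (\1_(B i) x - m i) = C) <-> forall i, i \in s -> B i x.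
  rewrite (_ : (_ = C) <-> \sum_(i <- s) (1 - \1_(B i) x : R) = 0); last first.
    have -> : \sum_(i <- s) (1 - \1_(B i) x : R) =
        C - \sum_(i <- s) (\1_(B i) x - m i).
      by rewrite -sumrB; apply: eq_bigr => i _; ring.
    by split=> [->|/eqP]; [rewrite subrr|rewrite subr_eq0 => /eqP].
  split=> [/eqP|BS]; last first.
    by rewrite big_seq big1// => i /BS Bi; rewrite indicE mem_set// subrr.
  rewrite psumr_eq0 => [/allP H i si|i _]; last first.
    by rewrite indicE subr_ge0; case: (_ \in _).
  have /implyP/(_ isT) := H i si; rewrite indicE.
  have [/set_mem//|_] := boolP (x \in _).
  by rewrite subr0 oner_eq0.
have gen i : generators (coord_embed (centered (A i))).
  exact/generator_embed/average_centered.
have Xf : X f by exact/Lp_closure_sub/span_sum.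
have mfC (g : Lp) : measurable (g @^-1` [set C]).
  by rewrite -[X in measurable X]setTI; exact: measurable_Lfun.
have mcap (B : I -> set Omega) : (forall i, measurable (B i)) ->
    measurable [set x | forall i, i \in s -> B i x].
  move=> mB; rewrite (_ : [set x | _] = \bigcap_(i in [set` s]) B i).
    exact: fin_bigcap_measurable.
  by apply/seteqP; split => x /= h i; exact: h.
have Tf : T f = (fun x => \sum_(i <- s) (\1_(S i) x - m i)) %[ae P].
  have H := operator_sum s (fun=> 1) gen.
  have {}TS : (\sum_(i <- s) 1 *: T (coord_embed (centered (A i))) : Lp) =
      (fun x => \sum_(i <- s) (\1_(S i) x - m i)) %[ae P].
    elim: s {C f max Xf mfC mcap H} => [|i s IH].
      by rewrite big_nil; apply: aeW => x _; rewrite big_nil.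
    rewrite big_cons scale1r; move: (TS i) IH.
    by apply: ae_eq_map2 => x Ti IHx; rewrite LfunDE Ti IHx big_cons.
  by move: H TS; apply: ae_eq_map2 => x -> ->.
have setE (B : I -> set Omega) : [set x | forall i, i \in s -> B i x] =
    (fun x => \sum_(i <- s) (\1_(B i) x - m i)) @^-1` [set C].
  by apply/seteqP; split => x /max.
rewrite setE -(prob_ae_eq_fun Tf (mfC _)); last first.
  by rewrite -setE; exact: mcap.
have := dT Xf (measurable_set1 C); rewrite /distribution/= /pushforward => ->.
rewrite (setE (fun i => [set x : Omega | A i (x (n_ i))])); congr (P _).
apply/seteqP; split => x /=; rewrite /f Lfun_sumE => <-; apply: eq_bigr => i _;
  by rewrite LfunZE mul1r.
Qed.

(** T(J_n e_A) has the distribution of e_A, hence two values, and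
[two_valued_coord] applies to the bounded representative Y. *)
Lemma image_centered n (A : set (cube n)) :
  exists k (B : set (cube k)),
    T (coord_embed (centered A)) =
    (fun x => \1_B (x k) - average (\1_A : cube n -> R)) %[ae P].
Proof.
set m := average _; pose f := coord_embed (centered A).
have Xf : X f.
  apply: Lp_closure_sub.
  have := span_sum [:: tt] (fun=> 1) (fun=> generator_embed (average_centered A)).
  by rewrite big_seq1 scale1r.
have [TX _ _ _] := lT.
pose D := T f @^-1` [set 1 - m].
have mpre B : measurable B -> measurable (T f @^-1` B).
  by move=> mB; rewrite -[X in measurable X]setTI; exact: measurable_Lfun.
have mD : measurable D by exact: mpre.
pose Y x : R := \1_D x - m.
have bY : bounded_mfun Y.
  by apply: bounded_mfunB; [exact: bounded_mfun_indic|exact: bounded_mfun_cst].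
have m2 : measurable [set 1 - m; - m] by exact: measurableU.
have TfY : T f = Y %[ae P].
  have : {ae P, forall x, (T f @^-1` [set 1 - m; - m]) x}.
    apply: prob1_ae; first exact: mpre.
    have := dT Xf m2; rewrite /distribution/= /pushforward => ->.
    rewrite (_ : _ @^-1` _ = setT) ?probability_setT//.
    apply/seteqP; split => [//|x _].
    change (\1_A (x n) - m = 1 - m \/ \1_A (x n) - m = - m); rewrite indicE.
    by case: (_ \in _); [left|right; rewrite sub0r].
  apply: filterS => x /= Tfx _; rewrite /Y indicE /D.
  case: Tfx => Tfx; first by rewrite mem_set.
  rewrite memNset ?sub0r// => /=; rewrite Tfx => /eqP.
  by rewrite -subr_eq0 opprB addrA addNr add0r oppr_eq0 oner_eq0.
have [||k [g Yg]] := @two_valued_coord _ Y (1 - m) (- m) bY.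
- exact: X_omega_weakly_additive (TX _ Xf) bY TfY.
- move=> x; rewrite /Y indicE.
  by case: (_ \in _); rewrite ?subrr ?mul0r// sub0r subrr mulr0.
exists k, [set u | g u = 1 - m].
move: TfY Yg; apply: ae_eq_map2 => x -> Yg; rewrite Yg indicE.
have [/set_mem -> //|/negP gx] := boolP (x k \in _).
rewrite -Yg /Y indicE memNset// => Dx; apply: gx; apply/mem_set => /=.
by rewrite -Yg /Y indicE mem_set.
Qed.

End operators.
(** * Embeddings are compositions on each coordinate *)

Lemma single_coordE k l (x : Omega) : k = l -> single_coord (x k) l = x l.
Proof. by move=> ->; exact: single_coord_in. Qed.

Section embedding_is_composition.
Variables (R : realType) (p : R) (p1 : 1 < p).
Local Notation P := (Omega_prob R).
Local Notation Lp := (LfunType P (lt1_le1E p1)).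
Local Notation cubeLp n := (LfunType (cube_prob R n) (lt1_le1E p1)).
Local Notation X := (X_omega (lt1_le1E p1)).
Variable T : Lp -> Lp.
Hypotheses (lT : bounded_linear_on X T) (dT : distributional_embedding T).

(** The events attached to two distinct points have a null intersection by
[joint_law]. Depending on different coordinates they would be independent, with
a product of positive numbers as the probability of the intersection; so one
coordinate serves all points of the cube. *)
Lemma image_centered_points n :
  exists k (B : cube n -> set (cube k)), forall w,
    T (coord_embed (centered p1 [set w])) =
    (fun x : Omega => \1_(B w) (x k) - average (\1_[set w] : cube n -> R)) %[ae P].
Proof.
have /choice[KB KBE] : forall w : cube n, exists KB : {k & set (cube k)},
    T (coord_embed (centered p1 [set w])) =
    (fun x : Omega => \1_(projT2 KB) (x (projT1 KB)) -
       average (\1_[set w] : cube n -> R)) %[ae P].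
  move=> w; have [k [B HB]] := image_centered lT dT [set w].
  by exists (existT _ k B).
pose K w := projT1 (KB w); pose B w : set (cube (K w)) := projT2 (KB w).
pose S w := [set x : Omega | B w (x (K w))].
have mS w : measurable (S w) by exact: measurable_coord_set.
have law (s : seq (cube n)) : P [set x | forall w, w \in s -> S w x] =
    P [set x | forall w, w \in s -> x n = w].
  by rewrite (joint_law lT dT s (n_ := fun=> n) (A := fun w => [set w]) mS).
have B_gt0 w : 0 < average (\1_(B w) : cube (K w) -> R).
  rewrite -lte_fin -cube_prob_average -Omega_prob_coord.
  have := law [:: w].
  rewrite (_ : [set x | _] = S w); last first.
    apply/seteqP; split => x /=; first by apply; rewrite mem_head.
    by move=> Sx v; rewrite inE => /eqP ->.
  rewrite (_ : [set x | _] = [set x : Omega | [set w] (x n)]); last first.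
    apply/seteqP; split => x /=; first by apply; rewrite mem_head.
    by move=> xw v; rewrite inE => /eqP ->.
  move=> ->; rewrite Omega_prob_coord cube_prob1 lte_fin invr_gt0 ltr0n.
  exact: card_cube_gt0.
have KK w v : K w = K v.
  apply/eqP; apply: contraT => Kwv.
  have wv : w != v by apply: contra_neq Kwv => ->.
  have := law [:: w; v].
  rewrite [X in _ = P X -> _](_ : _ = set0); last first.
    apply/seteqP; split => x //= H; move/eqP: wv; apply.
    by rewrite -(H w) ?mem_head// -(H v)// !inE eqxx orbT.
  rewrite measure0 (_ : [set x | _] = S w `&` S v); last first.
    apply/seteqP; split => x /= H.
      by split; apply: H; rewrite !inE eqxx ?orbT.
    by case: H => Sw Sv u; rewrite !inE => /orP[] /eqP ->.
  rewrite -expect_indic; last exact: measurableI.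
  rewrite (_ : expect P _ = average (\1_(B w)) * average (\1_(B v))).
    by move=> [] /eqP; rewrite mulf_eq0 !gt_eqF.
  rewrite -expect_coord_pair//; apply: eq_expect => x.
  by rewrite indicI.
pose k := K point; exists k, (fun w => [set u | B w (single_coord u (K w))]) => w.
move: (KBE w); apply: ae_eq_map => x ->; congr (_ - _).
rewrite !indicE; congr ((_ : bool)%:R); apply/idP/idP => /set_mem Bx; apply/mem_set;
  by move: Bx => /=; rewrite single_coordE//; exact: KK.
Qed.

(** As the e_w sum to zero, the indicators of the sets B w sum to 1 everywhere on
the cube k; phi u is the only w with u in B w. *)
Lemma image_coord_embed n :
  exists k (phi : cube k -> cube n), forall f : cubeLp n, average f = 0 ->
    T (coord_embed f) = (fun x : Omega => f (phi (x k))) %[ae P].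
Proof.
have [k [B TB]] := image_centered_points n; exists k.
pose m : R := #|{: cube n}|%:R^-1.
have avg w : average (\1_[set w] : cube n -> R) = m.
  by apply: EFin_inj; rewrite -cube_prob_average cube_prob1.
have gen w : (\bigcup_n (@coord_embed R p (lt1_le1E p1) n @`
    @mean_zero R p (lt1_le1E p1) n)) (coord_embed (centered p1 [set w : cube n])).
  exact/generator_embed/average_centered.
have Tsum (c : cube n -> R) :
    T (\sum_w c w *: coord_embed (centered p1 [set w])) =
    (fun x : Omega => \sum_w c w * (\1_(B w) (x k) - m)) %[ae P].
  have := operator_sum lT (index_enum (cube n)) c gen.
  have : (\sum_w c w *: T (coord_embed (centered p1 [set w])) : Lp) =
      (fun x : Omega => \sum_w c w * (\1_(B w) (x k) - m)) %[ae P].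
    elim: (index_enum (cube n)) => [|w s IH].
      by rewrite big_nil; apply: aeW => x _; rewrite big_nil.
    rewrite big_cons; move: (TB w) IH.
    by apply: ae_eq_map2 => x TBx IHx; rewrite LfunDE LfunZE TBx IHx big_cons avg.
  by apply: ae_eq_map2 => x -> ->.
have sum_point (c : cube n -> R) v : \sum_w c w * \1_[set w] v = c v.
  rewrite (bigD1 v)//= indicE mem_set// mulr1 big1 ?addr0// => w wv.
  by rewrite indicE memNset ?mulr0// => /= /esym/eqP; rewrite (negbTE wv).
have sumE (c : cube n -> R) (x : Omega) :
    (\sum_w c w *: coord_embed (centered p1 [set w]) : Lp) x =
    c (x n) - m * \sum_w c w.
  rewrite Lfun_sumE -{1}(sum_point c (x n)) mulr_sumr -sumrB.
  by apply: eq_bigr => w _; rewrite LfunZE centeredE avg mulrBr (mulrC m).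
(* The image of the zero sum of the e_w is zero. *)
have one (u : cube k) : \sum_w (\1_(B w) u : R) = 1.
  apply: (@coord_ae R k (fun u => \sum_w (\1_(B w) u : R) = 1)).
  have := operator_sum lT (@nil (cube n)) (fun=> 0) gen.
  have -> : (\sum_(w <- @nil (cube n)) 0 *: coord_embed (centered p1 [set w]) : Lp) =
      \sum_(w : cube n) 1 *: coord_embed (centered p1 [set w]).
    apply: Lfun_ext => x; rewrite sumE big_nil sumr_const /m.
    by rewrite mulVf ?subrr//; exact: card_cube_neq0.
  move: (Tsum (fun=> 1)); apply: filterS2 => x /(_ I) -> /(_ I).
  rewrite big_nil [X in _ = X]/(0 : R) => /eqP.
  under eq_bigr do rewrite mul1r.
  rewrite sumrB subr_eq0 => /eqP ->; rewrite sumr_const /m -[LHS]mulr_natl.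
  by rewrite mulfV//; exact: card_cube_neq0.
have ex (u : cube k) : exists w, B w u.
  apply: contrapT => /forallNP BN; have /eqP := one u.
  rewrite big1 => [|w _]; first by rewrite eq_sym oner_eq0.
  by rewrite indicE memNset.
have [phi phiB] := choice ex.
have phiE u w : (\1_(B w) u : R) = \1_[set w] (phi u).
  have := one u; rewrite (bigD1 (phi u))//= indicE mem_set//.
  move/(canRL (addKr _)); rewrite addNr => /eqP.
  rewrite psumr_eq0 => [/allP H|v _]; last by rewrite indicE; case: (_ \in _).
  have [->|wu] := eqVneq w (phi u); first by rewrite !indicE !mem_set.
  rewrite [RHS]indicE memNset => [|/= /esym/eqP]; last by rewrite (negbTE wu).
  by have /implyP/(_ wu)/eqP := H w (mem_index_enum w).
exists phi => f f0.
have sf0 : \sum_w f w = 0.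
  by move/eqP: f0; rewrite mulf_eq0 invr_eq0 (negbTE (card_cube_neq0 _ _)) orbF => /eqP.
have <- : (\sum_w f w *: coord_embed (centered p1 [set w]) : Lp) = coord_embed f.
  by apply: Lfun_ext => x; rewrite sumE sf0 mulr0 subr0.
move: (Tsum f); apply: ae_eq_map => x ->.
under eq_bigr do rewrite mulrBr phiE.
by rewrite sumrB sum_point -mulr_suml sf0 mul0r subr0.
Qed.

End embedding_is_composition.
(** * Regrouping the coordinates along the fibres *)

Section regrouping.
Variables (kappa : nat -> nat).

Lemma big_pmap_fibre (R : Type) (idx : R) (op : R -> R -> R) k (s : seq nat)
    (F : nat -> R) :
  \big[op/idx]_(i <- pmap (insub : nat -> option (fibre kappa k)) s)
    F (fibre_idx kappa k i) =
  \big[op/idx]_(n <- s | kappa n == k) F n.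
Proof.
elim: s => [|n s IH] /=; first by rewrite !big_nil.
rewrite [RHS]big_cons; case: insubP => [i nk <-|/negbTE nk] /=.
  by rewrite big_cons IH /fibre_idx (valP i).
by rewrite nk IH.
Qed.

Lemma mem_pmap_fibre k (s : seq nat) (i : fibre kappa k) :
  (i \in pmap (insub : nat -> option (fibre kappa k)) s) = (val i \in s).
Proof. exact: mem_pmap_sub. Qed.

Variables (R : realType) (p : R) (p1 : 1 < p).
Variable Phi : forall k : nat, cube k -> cube_prod (fibre_idx kappa k).
Variable Psi : Omega -> Omega.
Hypothesis PsiE : forall y k (i : fibre kappa k),
  Psi y (fibre_idx kappa k i) = Phi (y k) i.
Local Notation Lp := (LfunType (Omega_prob R) (lt1_le1E p1)).

Lemma fibre_sumE N (f : forall n, cube n -> R) k (y : Omega) :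
  \sum_(i \in [set i : fibre kappa k | (fibre_idx kappa k i <= N)%N])
    f (fibre_idx kappa k i) (Phi (y k) i) =
  \sum_(n <- iota 0 N.+1 | kappa n == k) f n (Psi y n).
Proof.
pose r := pmap (insub : nat -> option (fibre kappa k)) (iota 0 N.+1).
have rE i : (i \in r) = (fibre_idx kappa k i <= N)%N.
  by rewrite mem_pmap_fibre mem_iota.
rewrite (fsbigE r); first last.
- by move=> i /= iN; rewrite rE iN.
- by move=> i /=; rewrite rE.
- exact/pmap_sub_uniq/iota_uniq.
rewrite -(big_pmap_fibre _ _ _ _ (fun n => f n (Psi y n))) -/r.
rewrite big_seq_cond [RHS]big_seq; apply: eq_big => [i|i _]; last first.
  by rewrite PsiE.
by rewrite andb_idr// => ir; apply/mem_set => /=; rewrite -rE.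
Qed.

(** The right-hand side of the representation formula is the composition of the
function sum_n f_n(x_n) with Psi: both directions of the theorem use it in this
form. The outer sum has finite support because a fibre without index up to N
contributes 0. *)
Lemma regroup_coordinates N (f : forall n, LfunType (cube_prob R n) (lt1_le1E p1))
    (y : Omega) :
  (\sum_(k \in [set: nat])
    coord_embed (cube_Lp (lt1_le1E p1) (fun x : cube k =>
      \sum_(n \in [set n : fibre kappa k | (fibre_idx kappa k n <= N)%N])
        f (fibre_idx kappa k n) (Phi x n))) : Lp) y =
  \sum_(n < N.+1) f n (Psi y n).
Proof.
pose r := undup (map kappa (iota 0 N.+1)).
rewrite (fsbigE r) ?undup_uniq//; last first.
  move=> k _ kr; apply: Lfun_ext => x.
  transitivity (\sum_(n <- iota 0 N.+1 | kappa n == k) f n (Psi x n)).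
    by rewrite -(fibre_sumE N (fun n => f n)).
  rewrite big_seq_cond big1// => n /andP[ns /eqP nk].
  by case/negP: kr; rewrite mem_undup -nk map_f.
rewrite (eq_bigl xpredT) => [|k]; last exact: mem_setT.
rewrite Lfun_sumE.
transitivity (\sum_(k <- r) \sum_(n <- iota 0 N.+1 | kappa n == k) f n (Psi y n)).
  by apply: eq_bigr => k _; rewrite -(fibre_sumE N (fun n => f n)).
rewrite (exchange_big_dep xpredT)//= -(big_mkord xpredT (fun n => f n (Psi y n))).
rewrite /index_iota subn0; apply: eq_big_seq => n nr.
rewrite -big_filter (eq_filter (a2 := pred1 (kappa n)))//.
rewrite filter_pred1_uniq ?undup_uniq ?big_seq1//.
by rewrite mem_undup map_f.
Qed.

End regrouping.

(** * From an embedding to the maps kappa and Phi *)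

Lemma card_cube n : #|{: cube n}| = (2 ^ n.+1)%N.
Proof. by rewrite card_ffun card_bool card_ord. Qed.

Lemma prod_cube_prob1 (R : realType) (s : seq nat) :
  (\prod_(n <- s) cube_prob R n [set point] =
   ((2 ^ (\sum_(n <- s) n.+1))%:R^-1)%:E)%E.
Proof.
elim: s => [|n s IH]; first by rewrite !big_nil invr1.
by rewrite !big_cons IH cube_prob1 card_cube -EFinM expnD natrM invfM.
Qed.

Section forward.
Variables (R : realType) (p : R) (p1 : 1 < p).
Local Notation P := (Omega_prob R).
Local Notation Lp := (LfunType P (lt1_le1E p1)).
Local Notation cubeLp n := (LfunType (cube_prob R n) (lt1_le1E p1)).
Local Notation X := (X_omega (lt1_le1E p1)).
Variable T : Lp -> Lp.
Hypotheses (lT : bounded_linear_on X T) (dT : distributional_embedding T).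
Variables (kappa : nat -> nat) (phi : forall n, cube (kappa n) -> cube n).
Hypothesis Tphi : forall n (f : cubeLp n), average f = 0 ->
  T (coord_embed f) = (fun x : Omega => f (phi (x (kappa n)))) %[ae P].

Definition factor_map (y : Omega) : Omega := fun n => phi (y (kappa n)).

Definition fibre_map k (u : cube k) : cube_prod (fibre_idx kappa k) :=
  fun i => phi (single_coord u (kappa (fibre_idx kappa k i))).

Lemma factor_mapE (y : Omega) k (i : fibre kappa k) :
  factor_map y (fibre_idx kappa k i) = fibre_map (y k) i.
Proof.
by rewrite /factor_map /fibre_map single_coordE//; exact/esym/eqP/(valP i).
Qed.

(** The family phi_n(x_kappa(n)) has the law of (x_n), for arbitrary index
families: [joint_law] for the functions e_A. *)
Lemma factor_map_law (I : choiceType) (s : seq I) (n_ : I -> nat)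
    (A : forall i, set (cube (n_ i))) :
  P [set x | forall i, i \in s -> A i (factor_map x (n_ i))] =
  P [set x | forall i, i \in s -> A i (x (n_ i))].
Proof.
pose S i := [set x : Omega | A i (factor_map x (n_ i))].
apply: (joint_law lT dT s (S := S)) => i.
  exact: (measurable_coord_set (fun u => A i (phi u))).
exact: (Tphi (average_centered p1 (A i))).
Qed.

Lemma fibre_map_preserving k :
  measure_preserving (cube_prob R k) (product_prob R (@fibre_idx_inj kappa k))
    (@fibre_map k).
Proof.
apply: product_prob_pushforward => //; first exact: product_probP.
move=> J A.
rewrite -(Omega_prob_coord R [set u | forall i, i \in J -> A i (fibre_map u i)]).
rewrite -(Omega_prob_rectangle R A (@fibre_idx_inj kappa k) (fset_uniq J)).
rewrite -factor_map_law; congr (P _); apply/seteqP.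
by split => x /= H i iJ; have := H i iJ; rewrite factor_mapE.
Qed.

(** The preimage of a point under the fibre map has c points, out of 2^(k+1), and
probability 2^-(sum of n+1) > 0; so c >= 1 and 2^(sum of n+1) divides
2^(k+1). *)
Lemma fibre_sum_le k (s : seq nat) : uniq s -> (forall n, n \in s -> kappa n = k) ->
  (\sum_(n <- s) n.+1 <= k.+1)%N.
Proof.
move=> us sk.
pose C : set (cube k) :=
  [set u | forall n, n \in s -> phi (single_coord u (kappa n)) = point].
have : P [set x : Omega | C (x k)] = (\prod_(n <- s) cube_prob R n [set point])%E.
  rewrite -(Omega_prob_rectangle R (n_ := idfun) (fun n => [set point])
    (@inj_id nat) us).
  rewrite -(factor_map_law s (n_ := idfun) (fun n => [set point])).
  congr (P _); apply/seteqP; split => x /= H n ns; have := H n ns;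
    by rewrite /factor_map single_coordE// sk.
rewrite Omega_prob_coord cube_probE prod_cube_prob1 card_cube => -[].
set c := #|_| => cE.
have : (c * 2 ^ (\sum_(n <- s) n.+1) = 2 ^ k.+1)%N.
  apply/eqP; rewrite -(eqr_nat R) natrM.
  have two0 m : (2 ^ m)%:R != 0 :> R by rewrite pnatr_eq0 expn_eq0.
  by rewrite -[X in X * _](mulfVK (two0 k.+1)) cE mulrAC mulVf// mul1r.
move=> {}cE; rewrite -(@leq_exp2l 2)// -cE leq_pmull// lt0n.
by apply: contra_eq_neq cE => ->; rewrite mul0n eq_sym expn_eq0.
Qed.

End forward.

(** * From the maps kappa and Phi to an embedding *)

Section converse.
Variables (R : realType) (p : R) (p1 : 1 < p).
Local Notation P := (Omega_prob R).
Local Notation Lp := (LfunType P (lt1_le1E p1)).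
Local Notation cubeLp n := (LfunType (cube_prob R n) (lt1_le1E p1)).
Local Notation X := (X_omega (lt1_le1E p1)).
Local Notation "'N[ f ]" := (Lnorm P p%:E (EFin \o f%R)).

Section gluing.
Variables (kappa : nat -> nat)
  (Phi : forall k : nat, cube k -> cube_prod (fibre_idx kappa k)).
Hypothesis Phi_mp : forall k, measure_preserving (cube_prob R k)
  (product_prob R (@fibre_idx_inj kappa k)) (Phi (k := k)).

Definition glue (y : Omega) : Omega :=
  fun n => Phi (y (kappa n)) (exist _ n (eqxx (kappa n))).

Lemma glueE y k (i : fibre kappa k) :
  glue y (fibre_idx kappa k i) = Phi (y k) i.
Proof.
case: i => n nk; rewrite /glue /=; have nk' := eqP nk; subst k.
by rewrite (bool_irrelevance nk (eqxx _)).
Qed.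

(** The probability of a rectangle factors over the values k of kappa, as the
conditions with kappa n = k bear on the coordinate k alone; each factor is
computed in the product over the fibre, where Phi_k preserves measure. *)
Lemma glue_preserving : measure_preserving P P glue.
Proof.
apply: product_prob_pushforward; first exact: product_probP.
  apply: measurable_fun_cube_prod => n.
  exact: (measurableT_comp
    (f := fun u => Phi u (exist _ n (eqxx (kappa n)) : fibre kappa (kappa n))) _
    (@measurable_coord _ (@idfun nat) (kappa n))).
move=> J A.
(* K is the set of coordinates that matter, r k the part of the fibre over k that
   is constrained, and D k the constraint in the product over that fibre. *)
pose K := [fset kappa n | n in J]%fset.
pose r k := pmap (insub : nat -> option (fibre kappa k)) J.
pose D k : set (cube_prod (fibre_idx kappa k)) :=
  [set y | forall i, i \in r k -> A (fibre_idx kappa k i) (y i)].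
have rE k (i : fibre kappa k) : (i \in r k) = (fibre_idx kappa k i \in J).
  exact: mem_pmap_fibre.
transitivity (P [set x | forall k, k \in K -> (Phi (k := k) @^-1` D k) (x k)]).
  congr (P _); apply/seteqP; split => x /= H.
    move=> k kK i ir; rewrite -glueE; apply: H; by rewrite -rE.
  move=> n nJ; have nK : kappa n \in K by apply/imfsetP; exists n.
  have := H _ nK (exist _ n (eqxx (kappa n))); rewrite rE => /(_ nJ).
  by rewrite -glueE.
rewrite (Omega_rectangle R K (fun k => Phi (k := k) @^-1` D k)).
rewrite [RHS](partition_big_imfset _ kappa)/=.
apply: eq_bigr => k _.
have [_ ->] := Phi_mp k; last first.
  rewrite (_ : D k = \bigcap_(i in [set` r k])
      [set y | A (fibre_idx kappa k i) (y i)]).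
    by apply: fin_bigcap_measurable => // i _; rewrite -[X in measurable X]setTI;
      exact: measurable_coord.
  by apply/seteqP; split => x /= h i; exact: h.
have := product_probP R (@fibre_idx_inj kappa k) (seq_fset tt (r k))
  (fun i => A (fibre_idx kappa k i)).
rewrite (_ : [set x | _] = D k).
  move=> ->; rewrite -(big_pmap_fibre _ _ _ _ _ (fun n => cube_prob R n (A n))).
  apply: perm_big; apply: uniq_perm.
  - exact: fset_uniq.
  - exact/pmap_sub_uniq/fset_uniq.
  - by move=> i; rewrite seq_fsetE.
have E i : (i \in seq_fset tt (r k)) = (i \in r k) by rewrite seq_fsetE.
by apply/seteqP; split => x /= h i; [rewrite -E|rewrite E]; exact: h.
Qed.

End gluing.

Lemma Lfun_comp (Psi : Omega -> Omega) (f : Lp) : measure_preserving P P Psi ->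
  exists g : Lp, (forall x, g x = f (Psi x)) /\ 'N[g] = 'N[f].
Proof.
move=> [mPsi PsiP].
have NE : Lnorm P p%:E (EFin \o (f \o Psi)) = 'N[f].
  rewrite unlock /Lnorm; congr (_ `^ _)%E.
  have mf : measurable_fun setT (fun x => (`|(EFin \o f) x| `^ p)%E).
    apply: (measurableT_comp (measurable_poweR _)).
    apply: measurableT_comp => //.
    by apply/measurable_EFinP; exact: measurable_Lfun.
  rewrite -[LHS](@ge0_integral_pushforward _ _ _ _ _ _ mPsi P setT
    (fun x => (`|(EFin \o f) x| `^ p)%E))//; last by move=> x _; exact: poweR_ge0.
  by apply: eq_measure_integral => A mA _; exact: PsiP.
have fL : f \o Psi \in Lfun P p%:E.
  rewrite inE; apply/andP; split; rewrite inE/=.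
    exact: measurableT_comp (measurable_Lfun f) mPsi.
  by rewrite /finite_norm NE; exact: Lfunction_finite.
by exists (Lfun_Sub (lt1_le1E p1) fL).
Qed.

Variable T : Lp -> Lp.
Hypothesis lT : bounded_linear_on X T.
Variable Psi : Omega -> Omega.
Hypothesis Psi_mp : measure_preserving P P Psi.
Hypothesis TPsi : forall n (h : cubeLp n), average h = 0 ->
  T (coord_embed h) = (fun x : Omega => h (Psi x n)) %[ae P].

(** Both T and the composition with Psi are bounded, and they agree on the
span. *)
Lemma operator_comp (f : Lp) : X f -> T f = f \o Psi %[ae P].
Proof.
move=> Xf; have [TX Text Tlin [C TC]] := lT.
have [f' [f'E _]] := Lfun_comp f Psi_mp.
suff : T f = f' %[ae P] by apply: ae_eq_map => x ->; rewrite f'E.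
apply: Lnorm_small_ae_eq => e e0.
pose e' := e / (`|C| + 1).
have C1 : 0 < `|C| + 1 by rewrite ltr_wpDl.
have [|g Sg fg] := Xf e'; first by rewrite divr_gt0.
have Xg : X g by exact: Lp_closure_sub.
have Tg : T g = g \o Psi %[ae P].
  have [m [c [s [sG ->]]]] := Sg.
  have := operator_sum lT (index_enum 'I_m) c sG.
  have : (\sum_(i < m) c i *: T (s i) : Lp) =
      (\sum_(i < m) c i *: s i : Lp) \o Psi %[ae P].
    elim: (index_enum 'I_m) => [|i r IH].
      by rewrite !big_nil; exact: aeW.
    rewrite !big_cons; move: IH.
    have [n _ [h /mean_zeroE h0 hs]] := sG i.
    move: (TPsi h0); rewrite hs; apply: ae_eq_map2 => x Th IHx.
    by rewrite LfunDE LfunZE Th IHx -hs.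
  by apply: ae_eq_map2 => x -> ->.
have [d [dE dN]] := Lfun_comp (g - f) Psi_mp.
have gf' : T g - f' = d %[ae P].
  by move: Tg; apply: ae_eq_map => x Tgx; rewrite LfunBE Tgx dE f'E.
have Xfg : X (f - g).
  move=> r r0; have [g' Sg' fg'] := Xf r r0.
  exists (g' - g); first exact: span_sub.
  by rewrite opprB addrA subrK.
have Tfg : T (f - g) = T f - T g %[ae P].
  have := Tlin (-1) g f Xg Xf; rewrite !scaleN1r addrC.
  by apply: ae_eq_map => x ->; rewrite addrC.
apply: le_trans (Lnorm_triangle (T f) (T g) f') _.
rewrite -(Lnorm_ae_eq Tfg) (Lnorm_ae_eq gf') dN Lnorm_subC.
apply: (@le_trans _ _ ((`|C| + 1)%:E * 'N[f - g])%E).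
  rewrite EFinD ge0_muleDl ?lee_fin// mul1e leeD2r//.
  apply: le_trans (TC _ Xfg) _; apply: lee_wpmul2r; first exact: Lnorm_ge0.
  by rewrite lee_fin ler_norm.
apply: (@le_trans _ _ ((`|C| + 1)%:E * e'%:E)%E).
  by apply: lee_wpmul2l; rewrite ?lee_fin ltW.
by rewrite -EFinM lee_fin /e' mulrC divfK ?gt_eqF.
Qed.

Lemma comp_distributional_embedding : distributional_embedding T.
Proof.
move=> f Xf A mA; rewrite /distribution/= /pushforward.
have mf (g : Lp) : measurable (g @^-1` A).
  by rewrite -[X in measurable X]setTI; exact: measurable_Lfun.
have [mPsi PsiP] := Psi_mp.
rewrite (prob_ae_eq_fun (operator_comp Xf) (mf _)); last first.
  rewrite comp_preimage -[X in measurable X]setTI.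
  by apply: mPsi => //; exact: mf.
by rewrite comp_preimage; exact: PsiP.
Qed.

End converse.
Theorem theorem3p1 (R : realType) (p : R) (p1 : 1 < p)
    (T : LfunType (Omega_prob R) (lt1_le1E p1) ->
         LfunType (Omega_prob R) (lt1_le1E p1)) :
  bounded_linear_on (X_omega (lt1_le1E p1)) T ->
  distributional_embedding T <->
  exists (kappa : nat -> nat)
         (Phi : forall k : nat, cube k -> cube_prod (fibre_idx kappa k)),
    [/\ forall k : nat, finite_set (kappa @^-1` [set k]),
        forall k : nat,
          measure_preserving (cube_prob R k)
            (product_prob R (@fibre_idx_inj kappa k)) (Phi k),
        forall k : nat,
          (\sum_(n <- fset_set (kappa @^-1` [set k])) n.+1 <= k.+1)%N
      & forall (N : nat)
          (f : forall n : nat, LfunType (cube_prob R n) (lt1_le1E p1)),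
          (forall n : nat, (n <= N)%N -> mean_zero (lt1_le1E p1) n (f n)) ->
          T (\sum_(n < N.+1) coord_embed (f n)) =
          \sum_(k \in [set: nat])
            coord_embed (cube_Lp (lt1_le1E p1) (fun x : cube k =>
              \sum_(n \in [set n : fibre kappa k | (fibre_idx kappa k n <= N)%N])
                f (fibre_idx kappa k n) (Phi k x n)))
          %[ae Omega_prob R]].
Proof.
move=> lT; split=> [dT|[kappa [Phi [_ Phi_mp _ TE]]]].
  have HN n := image_coord_embed lT dT n.
  pose kappa n := projT1 (cid (HN n)).
  pose phi n : cube (kappa n) -> cube n := projT1 (cid (projT2 (cid (HN n)))).
  have Tphi n (f : LfunType (cube_prob R n) (lt1_le1E p1)) : average f = 0 ->
      T (coord_embed f) = (fun x : Omega => f (phi n (x (kappa n)))) %[ae Omega_prob R].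
    exact: (projT2 (cid (projT2 (cid (HN n))))).
  have sum_le k s := @fibre_sum_le R p p1 T lT dT kappa phi Tphi k s.
  have fin k : finite_set (kappa @^-1` [set k]).
    apply: (@sub_finite_set _ _ `I_k.+1); last exact: finite_II.
    move=> n /= nk; have := sum_le k [:: n] isT; rewrite big_seq1.
    by apply=> m; rewrite inE => /eqP ->.
  exists kappa, (fun k => @fibre_map kappa phi k); split => // [k|k|N f f0].
  - exact: (fibre_map_preserving lT dT Tphi).
  - apply: sum_le => [|n]; first exact: fset_uniq.
    by rewrite in_fset_set// inE.
  - have f0' (n : 'I_N.+1) : average (f n) = 0.
      by apply/mean_zeroE/f0; rewrite -ltnS.
    have gen (n : 'I_N.+1) := generator_embed (f0' n).
    have := operator_sum lT (index_enum 'I_N.+1) (fun=> 1) gen.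
    have : (\sum_(n < N.+1) 1 *: T (coord_embed (f n)) : LfunType _ _) =
        (fun y => \sum_(n < N.+1) f n (factor_map phi y n)) %[ae Omega_prob R].
      elim: (index_enum 'I_N.+1) => [|n s IH].
        by rewrite big_nil; apply: aeW => y _; rewrite big_nil.
      rewrite big_cons scale1r; move: (Tphi n (f n) (f0' n)) IH.
      by apply: ae_eq_map2 => y Ty IHy; rewrite LfunDE Ty IHy big_cons.
    under [in X in _ -> X -> _]eq_bigr do rewrite scale1r.
    apply: ae_eq_map2 => y Ty ->; rewrite Ty.
    by rewrite (regroup_coordinates (@factor_mapE kappa phi)).
have glue_mp := glue_preserving Phi_mp.
apply: (comp_distributional_embedding lT glue_mp) => n h h0.
(* The representation formula for the family that is h at n and 0 elsewhere. *)
pose f m : LfunType (cube_prob R m) (lt1_le1E p1) := eqtype.dfwith (fun=> 0) h m.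
have f0 m : (m <= n)%N -> mean_zero (lt1_le1E p1) m (f m).
  move=> _; apply/mean_zeroE; rewrite /f; have [<-|nm] := eqVneq n m.
    by rewrite dfwith_in.
  by rewrite dfwith_out// average_cst.
have last_term (F : forall m, LfunType (cube_prob R m) (lt1_le1E p1) -> R) :
    (forall m, F m 0 = 0) -> \sum_(m < n.+1) F m (f m) = F n h.
  move=> F0; rewrite big_ord_recr/= big1 ?add0r => [|m _].
    by rewrite /f dfwith_in.
  by rewrite /f dfwith_out ?F0// gtn_eqF.
have := TE n f f0.
rewrite (_ : \sum_(m < n.+1) coord_embed (f m) = coord_embed h); last first.
  apply: Lfun_ext => x; rewrite Lfun_sumE.
  exact: (last_term (fun m g => g (x m))).
apply: ae_eq_map => y ->.
rewrite (regroup_coordinates (glueE Phi)).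
exact: (last_term (fun m g => g (glue Phi y m))).
Qed.
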